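(* Let $L>0$ and $T=nL$ for some $n\in\mathbb{N}$. Let $\{\Sigma_h\}_h$ be a family of $\mathcal{S}^1_{0,}(\Sigma_h)$-admissible meshes of $\Sigma$, with $H^1$-stability constant independent of $h$, each satisfying the time-slice matching condition. Then, for each choice of the sign $\pm$, there is a constant $c_1^{\mathsf{K}}>0$ independent of $h$ such that $$c_1^{\mathsf{K}}\,\|w_h\|_{H^{1/2}_{0,}(\Sigma)}\;\le\;\sup_{0\ne\mu_h\in\mathcal{S}^1_{0,}(\Sigma_h)}\frac{\left|\left\langle\left(\pm\tfrac12\mathsf{Id}+\mathsf{K}\right)w_h,\mu_h\right\rangle_\Sigma\right|}{\|\mu_h\|_{[H^{1/2}_{0,}(\Sigma)]'}}\qquad\text{for all } w_h\in\mathcal{S}^1_{0,}(\Sigma_h).$$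
   Context: Spaces. $\Gamma=\{0,L\}$, $\Sigma=\Gamma\times[0,T]$. A function on $\Sigma$ is a pair $v=(v_0,v_L)=(v(0,\cdot),v(L,\cdot))$ of functions on $(0,T)$; $L^2(\Sigma)=L^2(0,T)\times L^2(0,T)$. $H^1_{0,}(\Sigma)=\{v: v_0,v_L\in H^1(0,T),\ v_0(0)=v_L(0)=0\}$ with norm $\|\partial_t v\|_{L^2(\Sigma)}$, and $H^{1/2}_{0,}(\Sigma):=[H^1_{0,}(\Sigma),L^2(\Sigma)]_{1/2}$ (Hilbert interpolation). $[H^{1/2}_{0,}(\Sigma)]'$ is its dual with the dual norm, and $\langle\cdot,\cdot\rangle_\Sigma$ is the duality pairing extending the $L^2(\Sigma)$ inner product (so $L^2(\Sigma)\subset[H^{1/2}_{0,}(\Sigma)]'$). Operator. $\mathsf{Id}$ is the identity and $\mathsf{K}$ is the double layer operator of the one-dimensional wave equation: $\mathsf{K}v(0,t)=-\tfrac12 v(L,t-L)$, $\mathsf{K}v(L,t)=-\tfrac12 v(0,t-L)$, where functions on $\Sigma$ are extended by zero to times $t\le0$. Meshes. A mesh $\Sigma_h=\Sigma_h^0\cup\Sigma_h^L$ of $\Sigma$ with maximal meshwidth $h$ consists of a partition $\Sigma_h^0$ of $\{0\}\times(0,T)$ and a partition $\Sigma_h^L$ of $\{L\}\times(0,T)$ into finitely many non-overlapping intervals. $\mathcal{S}^1_{0,}(\Sigma_h)\subset H^1_{0,}(\Sigma)$ is the space of functions that are, on each of the two boundary components, continuous and piecewise linear with respect to the mesh, and vanish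 at $t=0$. Admissibility. $\Sigma_h$ is $\mathcal{S}^1_{0,}(\Sigma_h)$-admissible if the $L^2(\Sigma)$-orthogonal projection $Q_h^0$ onto $\mathcal{S}^1_{0,}(\Sigma_h)$ is $H^1$-stable, i.e. $\|Q^0_hw\|_{H^1_{0,}(\Sigma)}\le c_{s,1}\|w\|_{H^1_{0,}(\Sigma)}$ for all $w\in H^1_{0,}(\Sigma)$, with a constant $c_{s,1}$ (the $H^1$-stability constant). Time-slice matching condition. With $T=nL$ and time slices $T_j:=((j-1)L,jL)$, $j=1,\dots,n$, each slice on each boundary component is a union of mesh elements (up to endpoints), and, identifying meshes on $T_j$ and $T_{j+1}$ via the time translation $t\mapsto t+L$, one has $\Sigma^0_{h|T_j}=\Sigma^L_{h|T_{j+1}}$ and $\Sigma^L_{h|T_j}=\Sigma^0_{h|T_{j+1}}$ for all $j=1,\dots,n-1$. *)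

(* Defs.v *)
From HB Require Import structures.
From mathcomp Require Import all_boot all_order all_algebra.
From mathcomp Require Import all_classical all_reals all_analysis.
Set Implicit Arguments.
Unset Strict Implicit.
Unset Printing Implicit Defensive.
Import Order.TTheory GRing.Theory Num.Theory.
Import numFieldNormedType.Exports.
Local Open Scope classical_set_scope.
Local Open Scope ring_scope.

(* A function on Sigma = {0, L} x [0, T] is a term v : bool -> R -> R, where
   v false = v(0, .) and v true = v(L, .).  Only the values on [0, T] matter:
   nothing below depends on the values of v outside [0, T]. *)

Section Lebesgue.
Context {R : realType}.
Implicit Types (T : R) (f g : R -> R) (v w : bool -> R -> R).

Definition L2 T f : Prop :=
  f \_ `]0, T[ \in Lfun (@lebesgue_measure R) 2%:E.

Definition L2S T v : Prop := forall b, L2 T (v b).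

(* Inner product of L2(Sigma); also the duality pairing between
   [H^{1/2}_{0,}(Sigma)]' and H^{1/2}_{0,}(Sigma) when one of its arguments is
   identified with the functional it induces. *)
Definition L2S_ip T v w : R :=
  \sum_(b : bool) \int[@lebesgue_measure R]_(t in `]0, T[) (v b t * w b t).

Definition L2S_norm T v : R := Num.sqrt (L2S_ip T v v).

End Lebesgue.

Section Sobolev.
Context {R : realType}.
Implicit Types (T : R) (f g phi : R -> R) (v w : bool -> R -> R).

(* C^1 functions with compact support in (0, T). *)
Definition test_function T phi : Prop :=
  [/\ forall x, derivable phi x 1,
      continuous (derive1 phi) &
      exists a b : R, [/\ 0 < a, b < T &
        forall x, phi x != 0 -> a <= x <= b]].

Definition weak_derivative T f g : Prop :=
  L2 T g /\
  forall phi, test_function T phi ->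
    \int[@lebesgue_measure R]_(t in `]0, T[) (f t * derive1 phi t) =
    - \int[@lebesgue_measure R]_(t in `]0, T[) (g t * phi t).

(* H^1(0, T) functions with f(0) = 0.  An element of H^1(0, T) is given by its
   representative that is continuous on [0, T]; the value at 0 is the value of
   this representative. *)
Definition H10 T f : Prop :=
  [/\ {within `[0, T], continuous f}, f 0 = 0 &
      exists g, weak_derivative T f g].

Definition H10S T v : Prop := forall b, H10 T (v b).

Definition weak_deriv T f : R -> R :=
  xget (fun=> 0) [set g | weak_derivative T f g].

Definition H10S_norm T v : R := L2S_norm T (fun b => weak_deriv T (v b)).

End Sobolev.

(* Interpolation space [X, Y]_{1/2} of a couple of Hilbert spaces X c Y, by the
   K-method with the quadratic K-functional
     K(t, u)^2 = inf_{v in X} |u - v|_Y^2 + t^2 |v|_X^2,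
     |u|_{1/2}^2 = 2/pi * int_0^oo t^{-2} K(t, u)^2 dt.
   The factor 2/pi makes |.|_{1/2} equal to |A^{1/2} .|_Y for the positive
   self-adjoint operator A in Y with domain X and |A .|_Y = |.|_X, because
   int_0^oo a^2 / (1 + t^2 a^2) dt = a * pi/2 for a > 0. *)
Section Interpolation.
Context {R : realType} {V : lmodType R}.
Variables (X Y : V -> Prop) (normX normY : V -> R).

Definition K_functional_sqr (t : R) (u : V) : R :=
  inf [set normY (u - v) ^+ 2 + t ^+ 2 * normX v ^+ 2 | v in X].

Definition interp_half_sqr (u : V) : \bar R :=
  ((2 / pi)%:E * \int[@lebesgue_measure R]_(t in `]0%R, +oo[)
                    (t ^- 2 * K_functional_sqr t u)%:E)%E.

Definition interp_half (u : V) : Prop := Y u /\ (interp_half_sqr u < +oo)%E.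

Definition interp_half_norm (u : V) : R := Num.sqrt (fine (interp_half_sqr u)).

End Interpolation.

Section HalfSpace.
Context {R : realType}.
Implicit Types (T L : R) (v w mu : bool -> R -> R).

Definition H12S T v : Prop :=
  interp_half (H10S T) (L2S T) (H10S_norm T) (L2S_norm T) v.

Definition H12S_norm T v : R :=
  interp_half_norm (H10S T) (H10S_norm T) (L2S_norm T) v.

(* Norm in [H^{1/2}_{0,}(Sigma)]' of the functional induced by mu in L2(Sigma).
   The condition v <> 0 is meant in L2(Sigma), i.e. almost everywhere. *)
Definition H12S_dual_norm T mu : R :=
  fine (ereal_sup [set (`|L2S_ip T mu v| / H12S_norm T v)%:E
                  | v in [set v | H12S T v /\ L2S_norm T v != 0]]).

Definition double_layer L v : bool -> R -> R :=
  fun b t => - 2^-1 * (if t - L <= 0 then 0 else v (~~ b) (t - L)).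

(* (1/2 Id + K) v if s = false and (-1/2 Id + K) v if s = true. *)
Definition half_id_double_layer (s : bool) L v : bool -> R -> R :=
  fun b t => (-1) ^+ s * 2^-1 * v b t + double_layer L v b t.

End HalfSpace.

(* A mesh of Sigma is M : bool -> seq R, where 0 :: M b is the increasing list
   of the nodes on the boundary component b. *)
Section Meshes.
Context {R : realType}.
Implicit Types (T L : R) (s : seq R) (M : bool -> seq R) (v w q : bool -> R -> R).

Definition is_mesh T M : Prop := forall b, itv_partition 0 T (M b).

(* The pair (x, y) stands for the element with endpoints x < y. *)
Definition mesh_elements s : seq (R * R) := zip (0 :: s) s.

Definition S1 T M v : Prop :=
  forall b, [/\ {within `[0, T], continuous (v b)}, v b 0 = 0 &
    forall e, e \in mesh_elements (M b) ->
      exists p q : R, forall t, e.1 < t < e.2 -> v b t = p + q * t].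

Definition L2_projection_rel T M w q : Prop :=
  S1 T M q /\ forall z, S1 T M z -> L2S_ip T (w - q) z = 0.

Definition Q0 T M w : bool -> R -> R :=
  xget (fun _ _ => 0) [set q | L2_projection_rel T M w q].

Definition H1_stable T M (cs : R) : Prop :=
  forall w, H10S T w -> H10S_norm T (Q0 T M w) <= cs * H10S_norm T w.

(* The j-th time slice is (j L, (j + 1) L), with j counted from 0. *)
Definition slice_elements L s (j : nat) : set (R * R) :=
  [set e | [/\ e \in mesh_elements s, j%:R * L <= e.1 & e.2 <= j.+1%:R * L]].

Definition slice_matching L (n : nat) M : Prop :=
  (forall b j, (j < n)%N ->
     [set` `[j%:R * L, j.+1%:R * L]] =
     \bigcup_(e in slice_elements L (M b) j) [set` `[e.1, e.2]]) /\
  (forall b j, (j.+1 < n)%N ->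
     slice_elements L (M (~~ b)) j.+1 =
     [set (e.1 + L, e.2 + L) | e in slice_elements L (M b) j]).

End Meshes.

(* Main.v *)
Require Import Defs.
From HB Require Import structures.
From mathcomp Require Import all_boot all_order all_algebra.
From mathcomp Require Import all_classical all_reals all_analysis.
From mathcomp Require Import measurable_realfun ring lra.
Set Implicit Arguments.
Unset Strict Implicit.
Unset Printing Implicit Defensive.
Import Order.TTheory GRing.Theory Num.Theory.
Import numFieldNormedType.Exports.
Local Open Scope classical_set_scope.
Local Open Scope ring_scope.

(** Let A be one of the operators 1/2 Id + K, -1/2 Id + K, let S be the space
    of splines on a mesh, and write |.| for the L2 norm, |.|_1 for the H^1 norm
    and (., .)_1 for its inner product.  Let k(t, z) be the K-functional, so
    that k(t, z)^2 is the infimum of |z - v|^2 + t^2 |v|_1^2 over v in H^1.  The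
    proof stays inside S; it needs neither the spectral decomposition behind the
    interpolation norm nor any integration of vector-valued functions.

    Two facts about S enter.  Slice matching says that the delay operator, which
    shifts by L and exchanges the two boundary points, maps S into itself
    ([delay_S1]).  It increases neither |.| nor |.|_1, and its n-th power
    vanishes on (0, n L).  As K is -1/2 times the delay, A is inverted on S by a
    finite Neumann sum which is bounded by 2 n in both norms ([neumann_fixed],
    [neumann_start], [neumann_norm_le]).  Stability of the L2 projection says
    that k does not change much when its competitors are restricted to S.

    Fix w in S and put u = A w.  For t > 0 let v_t in S minimise
    |u - v|^2 + t^2 |v|_1^2, so that <u - v_t, z> = t^2 (v_t, z)_1 for all z in
    S, and let e_t be the minimum.  Then
    - <u - v_t, u> = e_t ([galerkin_ip_self]);
    - <u - v_t, z>^2 <= (1 + cs^2) e_t k(t, z)^2 for every z in L2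
      ([galerkin_ip_le]), by Cauchy-Schwarz and stability of the projection;
    - k(t, w)^2 <= 4 n^2 e_t ([K2_le_energy]), because the Neumann sum of v_t
      competes for w.

    As k(t, z) increases with t, the square of the interpolation norm of z is
    comparable to the sum of k(t_i, z)^2 / t_i over dyadic points t_i = d 2^i,
    up to tails that are as small as wanted ([dyadic_sum_le_integral],
    [integral_le_dyadic_sum]).  Let N be the sum of e_(t_i) / t_i, which
    dominates the squared interpolation norm of w, and let y in S be the sum of
    (u - v_(t_i)) / t_i.  Then <y, u> = N, while another use of Cauchy-Schwarz
    gives <y, z>^2 <= C N |z|_(1/2)^2 ([dual_test_function]).  So the dual norm
    of y is at most (C N)^(1/2), and the quotient for y is at least
    (N / C)^(1/2).  Up to a factor, y approximates G u, where G is the positive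
    operator with |z|_(1/2) = |G^(1/2) z|.

    The H^1 norm is that of an arbitrarily chosen weak derivative.  It becomes
    a quadratic form thanks to the uniqueness of weak derivatives
    ([weak_derivative_unique]) and is computed on S through the classical
    derivative ([pl_weak_derivative]). *)

(** * Positive semidefinite forms on subspaces *)

Section Forms.
Context {R : realFieldType} {V : lmodType R}.
Implicit Types (S : V -> Prop) (B : V -> V -> R) (l F : V -> R).

Definition subspace S :=
  S 0 /\ forall a u v, S u -> S v -> S (a *: u + v).

Definition linear_on S l :=
  forall a u v, S u -> S v -> l (a *: u + v) = a * l u + l v.

(** Null vectors are allowed: the L2 form vanishes on functions that are zero
    almost everywhere, and functions are not identified here. *)
Definition psd_form S B :=
  [/\ forall u v, S u -> S v -> B u v = B v u,
      forall w, S w -> linear_on S (B^~ w) &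
      forall u, S u -> 0 <= B u u].

Lemma subspaceZ S a u : subspace S -> S u -> S (a *: u).
Proof. by move=> [S0 SL] Su; rewrite -[_ *: _]addr0; exact: SL. Qed.

Lemma subspaceD S u v : subspace S -> S u -> S v -> S (u + v).
Proof. by move=> [S0 SL] Su Sv; rewrite -[u]scale1r; exact: SL. Qed.

Lemma subspaceB S u v : subspace S -> S u -> S v -> S (u - v).
Proof.
by move=> hS Su Sv; rewrite -scaleN1r; apply: subspaceD => //; exact: subspaceZ.
Qed.

Lemma linear_on0 S l : subspace S -> linear_on S l -> l 0 = 0.
Proof.
move=> [S0 _] ll; have := ll 1 0 0 S0 S0.
by rewrite scale1r addr0 mul1r => /(congr1 (+%R^~ (- l 0))); rewrite addrK subrr.
Qed.

Lemma linear_onZ S l a u : subspace S -> linear_on S l -> S u ->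
  l (a *: u) = a * l u.
Proof.
move=> hS ll Su; have := ll a u 0 Su hS.1.
by rewrite addr0 (linear_on0 hS ll) addr0.
Qed.

Lemma linear_onD S l u v : linear_on S l -> S u -> S v -> l (u + v) = l u + l v.
Proof. by move=> ll Su Sv; have := ll 1 u v Su Sv; rewrite scale1r mul1r. Qed.

Lemma linear_onB S l u v : subspace S -> linear_on S l -> S u -> S v ->
  l (u - v) = l u - l v.
Proof.
move=> hS ll Su Sv; rewrite -scaleN1r (linear_onD ll)//; last exact: subspaceZ.
by rewrite (linear_onZ _ hS ll)// mulN1r.
Qed.

Lemma subspace_sum S m (c : 'I_m -> R) (x : 'I_m -> V) : subspace S ->
  (forall i, S (x i)) -> S (\sum_(i < m) c i *: x i).
Proof.
move=> hS Sx; apply: (big_ind S) => [|u v|i _]; first exact: hS.1.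
  exact: subspaceD.
exact: subspaceZ.
Qed.

Lemma linear_on_sum S l m (c : 'I_m -> R) (x : 'I_m -> V) : subspace S ->
  linear_on S l -> (forall i, S (x i)) ->
  l (\sum_(i < m) c i *: x i) = \sum_(i < m) c i * l (x i).
Proof.
move=> hS ll; elim: m c x => [|m IH] c x Sx.
  by rewrite !big_ord0; exact: linear_on0 ll.
rewrite !big_ord_recl ll ?IH//; exact: subspace_sum.
Qed.

Lemma psd_formr S B w : psd_form S B -> subspace S -> S w -> linear_on S (B w).
Proof.
move=> [Bs Bl _] hS Sw a u v Su Sv.
by rewrite !(Bs w)//; [exact: Bl|apply: hS.2].
Qed.

Lemma psd_formDZ S B t u v : subspace S -> psd_form S B -> S u -> S v ->
  B (t *: u + v) (t *: u + v) = t ^+ 2 * B u u + 2 * t * B u v + B v v.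
Proof.
move=> hS hB Su Sv; have [Bs Bl _] := hB.
have Sw : S (t *: u + v) by apply: hS.2.
rewrite (Bl _ Sw)// !(psd_formr hB hS)// (Bs v u)//; ring.
Qed.

Lemma psd_form_CS S B u v : subspace S -> psd_form S B -> S u -> S v ->
  B u v ^+ 2 <= B u u * B v v.
Proof.
move=> hS hB Su Sv; have [Bs Bl Bp] := hB.
have key t : 0 <= t ^+ 2 * B u u + 2 * t * B u v + B v v.
  by rewrite -(psd_formDZ _ hS hB)//; apply/Bp/hS.2.
have := Bp _ Su; rewrite le_eqVlt => /orP[/eqP u0|u0].
  have [->|uv0] := eqVneq (B u v) 0; first by rewrite expr0n/= -u0 mul0r.
  (* a parameter for which the affine polynomial 2 t B u v + B v v is -1 *)
  have := key (- (B v v + 1) / (2 * B u v)).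
  have -> : 2 * (- (B v v + 1) / (2 * B u v)) * B u v = - (B v v + 1).
    by field.
  by rewrite -u0; lra.
have := key (- B u v / B u u).
have -> : (- B u v / B u u) ^+ 2 * B u u + 2 * (- B u v / B u u) * B u v + B v v
   = (B u u * B v v - B u v ^+ 2) / B u u by field; rewrite gt_eqF.
by rewrite pmulr_lge0 ?invr_gt0// subr_ge0.
Qed.

(** By Cauchy-Schwarz; null vectors can therefore be carried along instead of
    being divided out. *)
Lemma psd_form_null S B u v : subspace S -> psd_form S B -> S u -> S v ->
  B v v = 0 -> B u v = 0.
Proof.
move=> hS hB Su Sv v0; have := psd_form_CS hS hB Su Sv.
by rewrite v0 mulr0 => h; apply/eqP; rewrite -sqrf_eq0 eq_le h sqr_ge0.
Qed.

Lemma linear_on_sub S S' l : (forall u, S' u -> S u) -> linear_on S l ->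
  linear_on S' l.
Proof. by move=> SS ll a u v /SS Su /SS Sv; exact: ll. Qed.

Lemma psd_form_sub S S' B : (forall u, S' u -> S u) -> psd_form S B ->
  psd_form S' B.
Proof.
move=> SS [Bs Bl Bp]; split; [|move=> w /SS Sw|]; auto.
exact: linear_on_sub (Bl _ Sw).
Qed.

Lemma psd_formD S B B' c : psd_form S B -> psd_form S B' -> 0 <= c ->
  psd_form S (fun u v => B u v + c * B' u v).
Proof.
move=> [Bs Bl Bp] [Bs' Bl' Bp'] c0; split.
- by move=> u v Su Sv; rewrite Bs// Bs'.
- by move=> w Sw a u v Su Sv; rewrite Bl// Bl'//; ring.
- by move=> u Su; rewrite addr_ge0 ?mulr_ge0 ?Bp ?Bp'.
Qed.

(** Gram-Schmidt on the number of functionals: intersecting with the kernel of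
    one more functional l lowers the dimension by at most one, and the missing
    direction may be chosen orthogonal to that kernel.  Finite dimension thus
    enters only through functionals that separate points modulo null vectors,
    and no basis of S has to be exhibited. *)
Lemma riesz_finite S B (ls : seq (V -> R)) F :
  subspace S -> psd_form S B ->
  (forall l, List.In l ls -> linear_on S l) ->
  (forall z, S z -> (forall l, List.In l ls -> l z = 0) -> B z z = 0) ->
  linear_on S F -> (forall z, S z -> B z z = 0 -> F z = 0) ->
  exists2 v, S v & forall z, S z -> B v z = F z.
Proof.
elim: ls S F => [|l ls IH] S F hS hB lin sep linF nullF.
  exists 0; first exact: hS.1.
  move=> z Sz; have Bz : B z z = 0 by apply: sep.
  by rewrite (psd_form_null hS hB hS.1 Sz Bz) nullF.
have linl : linear_on S l by apply: lin; left.
have linls l' : List.In l' ls -> linear_on S l' by move=> h; apply: lin; right.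
have [l0|] := pselect (forall z, S z -> l z = 0).
  apply: IH => // z Sz lz; apply: sep => // l' [<-|]; [exact: l0|exact: lz].
move=> /existsNP[e0 /not_implyP[Se0 /eqP le0]].
pose S' z := S z /\ l z = 0.
have SS u : S' u -> S u by case.
have hS' : subspace S'.
  split; first by split; [exact: hS.1|exact: linear_on0 linl].
  move=> a u v [Su lu] [Sv lv]; split; first exact: hS.2.
  by rewrite linl// lu lv mulr0 addr0.
have hB' := psd_form_sub SS hB.
have rep G : linear_on S G -> (forall z, S z -> B z z = 0 -> G z = 0) ->
    exists2 v, S' v & forall z, S' z -> B v z = G z.
  move=> linG nullG; apply: IH => //.
  - by move=> l' h; apply: linear_on_sub SS _; exact: linls.
  - by move=> z [Sz lz] h; apply: sep => // l' [<-//|]; exact: h.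
  - exact: linear_on_sub linG.
  - by move=> z /SS; exact: nullG.
have [p S'p pE] : exists2 v, S' v & forall z, S' z -> B v z = B e0 z.
  apply: rep; first exact: (psd_formr hB hS).
  by move=> z Sz; exact: (psd_form_null hS hB).
have [Sp lp] := S'p.
have [v' S'v vE] := rep _ linF nullF; have [Sv _] := S'v.
(* e is the missing direction, orthogonal to the kernel S' of l *)
pose e := e0 - p.
have Se : S e by exact: subspaceB.
have le : l e != 0 by rewrite (linear_onB hS linl)// lp subr0.
have [Bs Bl Bp] := hB.
have eE z : S' z -> B e z = 0.
  move=> S'z; have Sz := SS _ S'z.
  by rewrite (linear_onB hS (Bl _ Sz))// pE// subrr.
have dec z : S z -> exists c z', S' z' /\ z = c *: e + z'.
  move=> Sz; exists (l z / l e), (z - (l z / l e) *: e); split; last first.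
    by rewrite addrC subrK.
  have Sce : S ((l z / l e) *: e) by exact: subspaceZ.
  split; first exact: subspaceB.
  by rewrite (linear_onB hS linl)// (linear_onZ _ hS linl)// divfK// subrr.
have [e_0|e_neq0] := eqVneq (B e e) 0.
  exists v' => // z /dec[c [z' [S'z' ->]]]; have Sz' := SS _ S'z'.
  rewrite (psd_formr hB hS)// linF// (psd_form_null hS hB Sv Se e_0).
  by rewrite (nullF _ Se e_0) !mulr0 !add0r vE.
exists ((F e / B e e) *: e + v'); first exact: hS.2.
move=> z /dec[c [z' [S'z' ->]]]; have Sz' := SS _ S'z'.
rewrite Bl//; last exact: hS.2.
rewrite !(psd_formr hB hS)// linF// (eE _ S'z') (vE _ S'z') (Bs v' e)// (eE _ S'v).
by field.
Qed.

End Forms.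

Section FormNorm.
Context {R : rcfType} {V : lmodType R}.
Implicit Types (S : V -> Prop) (B : V -> V -> R).

Lemma psd_form_triangle S B u v : subspace S -> psd_form S B -> S u -> S v ->
  Num.sqrt (B (u + v) (u + v)) <= Num.sqrt (B u u) + Num.sqrt (B v v).
Proof.
move=> hS hB Su Sv; have [_ _ Bp] := hB.
have s0 : 0 <= Num.sqrt (B u u) + Num.sqrt (B v v).
  by rewrite addr_ge0 ?sqrtr_ge0.
rewrite -(ler_pXn2r (n := 2))// ?nnegrE ?sqrtr_ge0//.
rewrite sqr_sqrtr; last by apply: Bp; exact: subspaceD.
rewrite -[u]scale1r (psd_formDZ 1 hS hB Su Sv) scale1r sqrrD.
rewrite !sqr_sqrtr; [|exact: Bp..].
have : B u v <= Num.sqrt (B u u) * Num.sqrt (B v v).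
  rewrite -sqrtrM; last exact: Bp.
  rewrite (le_trans (ler_norm _))// -sqrtr_sqr ler_wsqrtr//.
  exact: psd_form_CS hB Su Sv.
by rewrite expr1n mul1r; lra.
Qed.

Lemma psd_form_scale S B a u : subspace S -> psd_form S B -> S u ->
  Num.sqrt (B (a *: u) (a *: u)) = `|a| * Num.sqrt (B u u).
Proof.
move=> hS hB Su; have [_ Bl _] := hB.
have Sa : S (a *: u) by exact: subspaceZ.
rewrite (linear_onZ _ hS (Bl _ Sa))// (linear_onZ _ hS (psd_formr hB hS Su))//.
by rewrite mulrA -expr2 sqrtrM ?sqr_ge0// sqrtr_sqr.
Qed.

End FormNorm.

Section CauchySchwarzSums.
Context {R : realFieldType}.

Lemma double_mul_le (x w p q a b : R) : 0 <= p -> 0 <= q -> 0 <= a -> 0 <= b ->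
  x ^+ 2 <= p * q -> w ^+ 2 <= a * b -> 2 * (x * w) <= p * b + a * q.
Proof.
move=> p0 q0 a0 b0 hx hw.
have s0 : 0 <= p * b + a * q by rewrite addr_ge0 ?mulr_ge0.
rewrite (le_trans (ler_norm _))// -(ler_pXn2r (n := 2))// ?nnegrE ?normr_ge0//.
rewrite real_normK ?num_real// (@le_trans _ _ (4 * ((p * q) * (a * b))))//.
  have : x ^+ 2 * w ^+ 2 <= (p * q) * (a * b) by rewrite ler_pM ?sqr_ge0.
  by rewrite !exprMn; lra.
by have := sqr_ge0 (p * b - a * q); nra.
Qed.

(** Cauchy-Schwarz in the plane, with the products of the coordinates only
    known through bounds. *)
Lemma sqr_add_le (x w p q a b : R) : 0 <= p -> 0 <= q -> 0 <= a -> 0 <= b ->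
  x ^+ 2 <= p * q -> w ^+ 2 <= a * b -> (x + w) ^+ 2 <= (p + a) * (q + b).
Proof.
by move=> p0 q0 a0 b0 hx hw; have := double_mul_le p0 q0 a0 b0 hx hw; nra.
Qed.

Lemma sqr_scale_le (c x a b : R) : x ^+ 2 <= a * b ->
  (c * x) ^+ 2 <= (c * a) * (c * b).
Proof.
by move=> h; rewrite exprMn [leRHS]mulrACA -expr2 ler_wpM2l ?sqr_ge0.
Qed.

(** The form in which stability of the projection is used: replacing a
    competitor of energy z by its projection, of energy b, costs a factor 1 +
    c. *)
Lemma mul_add_le (t c p q a b z : R) : 0 <= t -> 0 <= c -> 0 <= p -> 0 <= q ->
  0 <= a -> 0 <= z -> b <= c * z ->
  (p + t * a) * (q + t * b) <= (1 + c) * (p + t * a) * (q + t * z).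
Proof.
move=> t0 c0 p0 q0 a0 z0 bcz.
rewrite (mulrC (1 + c)) -mulrA ler_wpM2l ?addr_ge0 ?mulr_ge0//.
have := ler_wpM2l t0 bcz; have := mulr_ge0 c0 q0; have := mulr_ge0 t0 z0.
by lra.
Qed.

Lemma sqr_sum_le m (x a b : 'I_m -> R) :
  (forall i, 0 <= a i) -> (forall i, 0 <= b i) ->
  (forall i, x i ^+ 2 <= a i * b i) ->
  (\sum_(i < m) x i) ^+ 2 <= (\sum_(i < m) a i) * (\sum_(i < m) b i).
Proof.
move=> a0 b0; elim: m x a b a0 b0 => [|m IH] x a b a0 b0 xab.
  by rewrite !big_ord0 mulr0 expr0n.
by rewrite !big_ord_recl sqr_add_le ?IH ?sumr_ge0.
Qed.

End CauchySchwarzSums.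

(** * Square integrable functions *)

Section SquareIntegrable.
Context {R : realType}.
Notation mu := (@lebesgue_measure R).
Implicit Types (T : R) (D : set R) (f g : R -> R).

(** The space L2 over any set, so that intervals can be cut into pieces. *)
Definition sqint D f : Prop := f \_ D \in Lfun mu 2%:E.

Let Lfun2_submod : submod_closed (Lfun mu 2%:E).
Proof. by apply: Lfun_submod_closed; exact: lee1n. Qed.

Lemma sqint_meas D f : measurable D -> sqint D f -> measurable_fun D f.
Proof.
move=> mD /andP[/[!inE] mf _]; apply/(measurable_restrictT _ _).2 => //.
Qed.

Lemma eq_sqint D f g : {in D, f =1 g} -> sqint D f -> sqint D g.
Proof.
move=> fg; rewrite /sqint (_ : f \_ D = g \_ D)//; apply/funext => x.
by rewrite !patchE; case: ifPn => // xD; rewrite fg.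
Qed.

Lemma sqint_lin D a f g : sqint D f -> sqint D g ->
  sqint D (fun t => a * f t + g t).
Proof.
move=> sf sg; rewrite /sqint.
rewrite (_ : _ \_ D = a *: (f \_ D) + g \_ D); last first.
  apply/funext => x; rewrite -[RHS]/(a * (f \_ D) x + (g \_ D) x).
  rewrite !patchE; case: ifPn => _ //. by rewrite mulr0 addr0.
by apply: Lfun2_submod.2.
Qed.

Lemma sqintM D f g : measurable D -> sqint D f -> sqint D g ->
  mu.-integrable D (EFin \o (fun t => f t * g t)).
Proof.
move=> mD sf sg; have /Lfun1_integrable := Lfun2_mul_Lfun1 sf sg.
rewrite (_ : _ \* _ = (fun t => f t * g t) \_ D); last first.
  apply/funext => x; rewrite /= !patchE; case: ifPn => // _.
  by rewrite mulr0.
by move=> h; apply/integrable_mkcond => //; rewrite restrict_EFin.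
Qed.

Lemma sqintP D f : measurable D -> measurable_fun D f ->
  mu.-integrable D (EFin \o (fun t => f t ^+ 2)) -> sqint D f.
Proof.
move=> mD mf /integrable_mkcond => /(_ mD) /integrableP[_ If].
apply/andP; rewrite !inE /=; split.
  exact/(measurable_restrictT _ _).1.
rewrite /finite_norm unlock /Lnorm poweR_lty//.
apply: le_lt_trans If; rewrite le_eqVlt; apply/orP; left; apply/eqP.
apply: eq_integral => x _; rewrite /= !patchE; case: ifPn => _ /=.
  by rewrite powR_mulrn// -normrX.
by rewrite normr0 powR0 ?abse0// pnatr_eq0.
Qed.

Lemma sqint_bounded D f M : measurable D -> (mu D < +oo)%E ->
  measurable_fun D f -> (forall t, D t -> `|f t| <= M) -> sqint D f.
Proof.
move=> mD Dfin mf fM; apply: sqintP => //.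
apply: measurable_bounded_integrable => //; first exact: measurable_funX.
exists (M ^+ 2); split; first exact: num_real.
move=> x Mx t Dt; rewrite /= normrX (le_trans _ (ltW Mx))//.
by rewrite lerXn2r ?nnegrE//; [apply: le_trans (fM _ Dt)|exact: fM].
Qed.

Lemma lebesgue_itv_lty (a b : R) (x y : bool) :
  (mu [set` Interval (BSide x a) (BSide y b)] < +oo)%E.
Proof.
by rewrite lebesgue_measure_itv/=; case: ifP => _ //; rewrite -EFinB ltry.
Qed.

Lemma sqint_set0 f : sqint set0 f.
Proof.
rewrite /sqint (_ : f \_ set0 = 0).
  exact: Lfun2_submod.1.
by apply/funext => x; rewrite patchE in_set0.
Qed.

Lemma sqintU A B f : [disjoint A & B] -> sqint A f -> sqint B f ->
  sqint (A `|` B) f.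
Proof.
move=> /disj_setPS AB sA sB; rewrite /sqint.
rewrite (_ : _ \_ (A `|` B) = 1 *: (f \_ A) + f \_ B); last first.
  apply/funext => x; rewrite -[RHS]/(1 * (f \_ A) x + (f \_ B) x).
  rewrite mul1r !patchE in_setU.
  case: (boolP (x \in A)) => [/set_mem xA|_] /=; last by rewrite add0r.
  case: ifPn => [/set_mem xB|_]; last by rewrite addr0.
  by have := AB x (conj xA xB).
by apply: Lfun2_submod.2.
Qed.

Lemma sqint_sub A B f : measurable A -> measurable B -> A `<=` B ->
  sqint B f -> sqint A f.
Proof.
move=> mA mB AB sf; apply: sqintP => //.
  by apply: measurable_funS (sqint_meas mB sf).
by apply: integrableS (sqintM mB sf sf).
Qed.

Lemma within_continuous_sqint_cc a b f :
  {within `[a, b], continuous f} -> sqint `[a, b] f.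
Proof.
move=> cf.
have mf : measurable_fun `[a, b] f by exact: subspace_continuous_measurable_fun.
have /compact_bounded[M [_ Mf]] :=
  continuous_compact cf (@segment_compact _ a b).
apply: (@sqint_bounded _ _ (M + 1)) => //; first exact: lebesgue_itv_lty.
by move=> t tab; apply: Mf; [rewrite ltrDl|exists t].
Qed.

Lemma within_continuous_sqint a b f :
  {within `[a, b], continuous f} -> sqint `]a, b[ f.
Proof.
move=> /within_continuous_sqint_cc; apply: sqint_sub => //.
exact: subset_itvW.
Qed.

Lemma Rintegral_eq_ae D f g : measurable D -> measurable_fun D f ->
  measurable_fun D g -> ae_eq mu D f g ->
  \int[mu]_(t in D) f t = \int[mu]_(t in D) g t.
Proof.
move=> mD mf mg fg; congr fine; apply: ae_eq_integral => //.
- exact/measurable_EFinP.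
- exact/measurable_EFinP.
- exact: (ae_eq_comp EFin fg).
Qed.

End SquareIntegrable.

Section L2Sigma.
Context {R : realType}.
Notation mu := (@lebesgue_measure R).
Implicit Types (T : R) (v w : bool -> R -> R).

Lemma L2S_subspace T : subspace (L2S T).
Proof.
split=> [b|a u v Lu Lv b]; last exact: sqint_lin (Lu b) (Lv b).
apply: (@sqint_bounded _ _ _ 0) => //.
- exact: lebesgue_itv_lty.
- exact: measurable_cst.
- by move=> t _; rewrite normr0.
Qed.

Lemma L2S_mul T v w b : L2S T v -> L2S T w ->
  mu.-integrable `]0, T[ (EFin \o (fun t => v b t * w b t)).
Proof. by move=> Lv Lw; exact: sqintM (Lv b) (Lw b). Qed.

Lemma L2S_form T : psd_form (L2S T) (L2S_ip T).
Proof.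
split.
- move=> u v _ _; apply: eq_bigr => b _; apply: eq_Rintegral => t _.
  by rewrite mulrC.
- move=> w Lw a u v Lu Lv; rewrite /L2S_ip mulr_sumr -big_split/=.
  apply: eq_bigr => b _.
  rewrite -RintegralZl//; last exact: L2S_mul.
  rewrite -RintegralD//=.
  + by apply: eq_Rintegral => t _; rewrite mulrDl mulrA.
  + rewrite (_ : _ \o _ = fun x => (a%:E * (u b x * w b x)%:E)%E)//.
    exact: integrableZl (L2S_mul b Lu Lw).
  + exact: L2S_mul.
- move=> u _; apply: sumr_ge0 => b _; apply: Rintegral_ge0 => t _.
  exact: sqr_ge0.
Qed.

Lemma L2S_ip_ge0 T v : 0 <= L2S_ip T v v.
Proof. by apply: sumr_ge0 => b _; apply: Rintegral_ge0 => t _; exact: sqr_ge0. Qed.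

Lemma L2S_normE T v : L2S_norm T v = Num.sqrt (L2S_ip T v v).
Proof. by []. Qed.

Lemma L2S_norm_ge0 T v : 0 <= L2S_norm T v.
Proof. exact: sqrtr_ge0. Qed.

Lemma L2S_norm_sqr T v : L2S_norm T v ^+ 2 = L2S_ip T v v.
Proof. exact/sqr_sqrtr/L2S_ip_ge0. Qed.

Lemma eq_L2S_ip T u u' v v' : (forall b, {in `]0, T[%classic, u b =1 u' b}) ->
  (forall b, {in `]0, T[%classic, v b =1 v' b}) ->
  L2S_ip T u v = L2S_ip T u' v'.
Proof.
move=> uu vv; apply: eq_bigr => b _; apply: eq_Rintegral => t tT.
by rewrite uu ?vv.
Qed.

Lemma ae_L2S_ip T u u' v : L2S T u -> L2S T u' -> L2S T v ->
  (forall b, ae_eq mu `]0, T[%classic (u b) (u' b)) -> L2S_ip T u v = L2S_ip T u' v.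
Proof.
move=> Lu Lu' Lv uu; apply: eq_bigr => b _; apply: Rintegral_eq_ae => //.
- by apply/measurable_EFinP; exact: measurable_int (L2S_mul b Lu Lv).
- by apply/measurable_EFinP; exact: measurable_int (L2S_mul b Lu' Lv).
- by have := uu b; apply: filterS => t h Dt; rewrite h.
Qed.

End L2Sigma.

(** * Smooth approximations of the indicator of an interval *)

Section Bumps.
Context {R : realType}.
Implicit Types (a b x : R).

(** The simplest C^1 function with support a half-line. *)
Definition pos_sqr x : R := Num.max x 0 ^+ 2.

Lemma continuous_pos_part : continuous (fun x : R => Num.max x 0).
Proof. by move=> x; apply: continuous_max; [exact: cvg_id|exact: cvg_cst]. Qed.

Lemma is_derive_pos_sqr x : is_derive x 1 pos_sqr (2 * Num.max x 0).
Proof.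
have [x0|x0|->] := ltgtP x 0.
- rewrite mulr0.
  apply: (@near_eq_is_derive _ _ _ (cst 0)).
  near=> z; have z0 : z < 0 by near: z; exact: lt_nbhsl.
  by rewrite /pos_sqr /= max_r ?ltW// expr0n.
- have dsq : is_derive x 1 ((id : R -> R) ^+ 2) (2 * x).
    by apply: is_derive_eq; rewrite /= expr1 [_ *: _]mulr1.
  apply: near_eq_is_derive dsq.
  near=> z; have z0 : 0 < z by near: z; exact: lt_nbhsr.
  by rewrite /pos_sqr max_l// ltW.
- rewrite mulr0; apply/is_derive1_caratheodory.
  exists (fun z => Num.max z 0); split => [z| |]; last by rewrite maxxx.
  + rewrite /pos_sqr maxxx expr0n/= !subr0 expr2.
    by have [z0|z0] := leP z 0; rewrite ?mul0r.
  + exact: continuous_pos_part.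
Unshelve. all: by end_near. Qed.

Lemma pos_sqr_ge0 x : 0 <= pos_sqr x. Proof. exact: sqr_ge0. Qed.

Lemma pos_sqr0 x : x <= 0 -> pos_sqr x = 0.
Proof. by move=> x0; rewrite /pos_sqr max_r// expr0n. Qed.

Lemma pos_sqrE x : 0 <= x -> pos_sqr x = x ^+ 2.
Proof. by move=> x0; rewrite /pos_sqr max_l. Qed.

Lemma continuous_pos_sqr : continuous pos_sqr.
Proof.
move=> x; apply: differentiable_continuous; apply/derivable1_diffP.
by have [] := is_derive_pos_sqr x.
Qed.

(** The factor (b - a)^4 keeps the values in [0, 1], as powers of 1 - bump
    need. *)
Definition bump a b x : R := pos_sqr (x - a) * pos_sqr (b - x) / (b - a) ^+ 4.

Definition dbump a b x : R :=
  (2 * Num.max (x - a) 0 * pos_sqr (b - x) -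
   pos_sqr (x - a) * (2 * Num.max (b - x) 0)) / (b - a) ^+ 4.

Lemma is_derive_bump a b x : is_derive x 1 (bump a b) (dbump a b x).
Proof.
have da : is_derive x 1 ((id : R -> R) - cst a) 1.
  by apply: is_derive_eq; rewrite subr0.
have db : is_derive x 1 (cst b - (id : R -> R)) (- 1).
  by apply: is_derive_eq; rewrite sub0r.
have d1 := @is_derive1_comp R pos_sqr _ x _ _ (is_derive_pos_sqr _) da.
have d2 := @is_derive1_comp R pos_sqr _ x _ _ (is_derive_pos_sqr _) db.
rewrite (_ : bump a b = ((b - a) ^- 4) *:
  ((pos_sqr \o ((id : R -> R) - cst a)) *
   (pos_sqr \o (cst b - (id : R -> R))))); last first.
  by apply/funext => z; rewrite /bump mulrC.
by apply: is_derive_eq; rewrite /dbump /= !fctE /GRing.scale /=; ring.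
Qed.

Lemma continuous_dbump a b : continuous (dbump a b).
Proof.
move=> x; apply: cvgM; last exact: cvg_cst.
have c1 : (fun x => x - a) z @[z --> x] --> x - a.
  by apply: cvgB; [exact: cvg_id|exact: cvg_cst].
have c2 : (fun x => b - x) z @[z --> x] --> b - x.
  by apply: cvgB; [exact: cvg_cst|exact: cvg_id].
apply: cvgB.
- apply: cvgM; last exact: continuous_comp c2 (@continuous_pos_sqr _).
  apply: cvgM; first exact: cvg_cst.
  exact: continuous_comp c1 (@continuous_pos_part _).
- apply: cvgM; first exact: continuous_comp c1 (@continuous_pos_sqr _).
  apply: cvgM; first exact: cvg_cst.
  exact: continuous_comp c2 (@continuous_pos_part _).
Qed.

Lemma bump_out a b x : ~~ (a < x < b) -> bump a b x = 0.
Proof.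
rewrite /bump negb_and -!leNgt => /orP[xa|bx].
  by rewrite (@pos_sqr0 (x - a)) ?subr_le0// !mul0r.
by rewrite (@pos_sqr0 (b - x)) ?subr_le0// mulr0 mul0r.
Qed.

Lemma bump_in a b x : a < x < b -> 0 < bump a b x <= 1.
Proof.
move=> /andP[ax xb].
have ab : 0 < b - a by rewrite subr_gt0 (lt_trans ax).
have xa0 : 0 < x - a by rewrite subr_gt0.
have bx0 : 0 < b - x by rewrite subr_gt0.
rewrite /bump (pos_sqrE (ltW xa0)) (pos_sqrE (ltW bx0)).
have h4 : 0 < (b - a) ^+ 4 by exact: exprn_gt0.
apply/andP; split; first by rewrite divr_gt0// mulr_gt0// exprn_gt0.
rewrite ler_pdivrMr// mul1r -exprMn (exprM _ 2 2) lerXn2r ?nnegrE ?sqr_ge0//.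
  by rewrite mulr_ge0 ?ltW.
by rewrite expr2 ler_pM ?ltW//; lra.
Qed.

(** Any C^1 bump serves as profile; the k-th power of one minus the bump forces
    convergence to the indicator of the interval without any further
    smoothing. *)
Definition approx_indic a b (k : nat) x : R := 1 - (1 - bump a b x) ^+ k.

Lemma is_derive_approx_indic a b k x :
  is_derive x 1 (approx_indic a b k)
    (k%:R * (1 - bump a b x) ^+ k.-1 * dbump a b x).
Proof.
have db := is_derive_bump a b x.
rewrite (_ : approx_indic a b k = cst 1 - (cst 1 - bump a b) ^+ k); last first.
  by apply/funext => z; rewrite /approx_indic; congr (_ - _); elim: k => // k IH;
     rewrite !exprS IH.
apply: is_derive_eq.
by rewrite !sub0r /GRing.scale/= mulrN opprK.
Qed.

Lemma approx_indic_test (T : R) a b k : 0 < a -> b < T ->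
  test_function T (approx_indic a b k).
Proof.
move=> a0 bT; split.
- by move=> x; have [] := is_derive_approx_indic a b k x.
- rewrite (_ : derive1 _ =
    fun x => k%:R * (1 - bump a b x) ^+ k.-1 * dbump a b x); last first.
    apply/funext => x; rewrite derive1E.
    by have [_ ->] := is_derive_approx_indic a b k x.
  move=> x; apply: cvgM; last exact: continuous_dbump.
  apply: cvgM; first exact: cvg_cst.
  apply: (@continuous_comp _ _ _ (fun x => 1 - bump a b x) (fun y => y ^+ k.-1)).
    apply: cvgB; first exact: cvg_cst.
    apply: differentiable_continuous; apply/derivable1_diffP.
    by have [] := is_derive_bump a b x.
  exact: exprn_continuous.
- exists a, b; split => // x; apply: contraNT => h.
  rewrite /approx_indic bump_out ?subr0 ?expr1n ?subrr//.
  by apply: contra h => /andP[/ltW -> /ltW ->].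
Qed.

Lemma approx_indic_bound a b k x : `|approx_indic a b k x| <= 1.
Proof.
have h : 0 <= 1 - bump a b x <= 1.
  case: (boolP (a < x < b)) => [/bump_in/andP[p q]|/bump_out ->]; last by lra.
  by apply/andP; split; lra.
have /andP[h0 h1] := h.
have := exprn_ge0 k h0; have := exprn_ile1 k h0 h1.
by rewrite /approx_indic ler_norml => *; apply/andP; split; lra.
Qed.

Lemma approx_indic_cvg a b x :
  approx_indic a b k x @[k --> \oo] --> (\1_`]a, b[ x : R).
Proof.
rewrite indicE; case: (boolP (a < x < b)) => [axb|xout].
  rewrite mem_set/=; last by rewrite in_itv.
  rewrite -[X in _ --> X]subr0; apply: cvgB; first exact: cvg_cst.
  apply: cvg_expr; have /andP[p q] := bump_in axb.
  by rewrite ger0_norm; lra.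
rewrite memNset/=; last by rewrite in_itv; apply/negP.
rewrite (_ : (fun k => _) = cst 0); first exact: cvg_cst.
by apply/funext => k; rewrite /approx_indic bump_out// subr0 expr1n subrr.
Qed.

End Bumps.

(** * The fundamental lemma of the calculus of variations *)

Section FundamentalLemma.
Context {R : realType}.
Notation mu := (@lebesgue_measure R).
Implicit Types (a b T : R) (d f g : R -> R).

Lemma sqint_integrable a b f : sqint `]a, b[ f ->
  mu.-integrable `]a, b[ (EFin \o f).
Proof.
move=> sf; have s1 : sqint `]a, b[ (cst 1 : R -> R).
  apply: (@sqint_bounded _ _ _ 1) => //.
  - exact: lebesgue_itv_lty.
  - by move=> t _; rewrite normr1.
have := sqintM _ sf s1; rewrite (_ : (fun t => _) = f); first exact.
by apply/funext => t; rewrite /= mulr1.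
Qed.

(** Dominated convergence along [approx_indic a b]. *)
Lemma test_integral_itv T d a b : mu.-integrable `]0, T[ (EFin \o d) ->
  (forall phi, test_function T phi -> \int[mu]_(t in `]0, T[) (d t * phi t) = 0) ->
  0 < a -> b < T -> \int[mu]_(t in `]a, b[) d t = 0.
Proof.
move=> id d0 a0 bT.
have sub : `]a, b[ `<=` `]0, T[.
  by apply: subset_itv; rewrite bnd_simp ltW.
have md : measurable_fun `]0, T[ d.
  by apply/measurable_EFinP; exact: measurable_int id.
have mphi k : measurable_fun `]0, T[ (approx_indic a b k).
  apply: measurable_funTS; apply: continuous_measurable_fun => x.
  apply: differentiable_continuous; apply/derivable1_diffP.
  by have [] := is_derive_approx_indic a b k x.
pose dab t := d t * \1_`]a, b[ t.
have [_ _] : [/\ mu.-integrable `]0, T[ (EFin \o dab),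
    ([sequence \int[mu]_(x in `]0%R, T[) `|(d x * approx_indic a b n x)%:E -
       (EFin \o dab) x|]_n @ \oo --> 0)%E &
    ([sequence \int[mu]_(x in `]0%R, T[) (d x * approx_indic a b n x)%:E]_n @ \oo
      --> \int[mu]_(x in `]0%R, T[) (EFin \o dab) x)%E].
  apply: (@dominated_convergence _ _ _ mu _ _ _ _ (fun x => `|(d x)%:E|%E)) => //.
  - move=> n; apply/measurable_EFinP; exact: measurable_funM md (mphi n).
  - exact/measurable_EFinP/measurable_funM.
  - apply: aeW => x _; apply: cvg_EFin; first exact: nearW.
    by apply: cvgM; [exact: cvg_cst|exact: approx_indic_cvg].
  - exact: integrable_abse.
  - apply: aeW => x n _; rewrite lee_fin normrM ler_piMr//.
    exact: approx_indic_bound.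
rewrite (_ : [sequence _]_n = cst 0%E); last first.
  apply/funext => n /=; have := d0 _ (approx_indic_test n a0 bT).
  rewrite /Rintegral => h; rewrite -[LHS]fineK ?h//.
  apply: integrable_fin_num => //; apply/integrableP; split.
    by apply/measurable_EFinP; exact: measurable_funM md (mphi n).
  have /integrableP[_] := id; apply: le_lt_trans.
  apply: ge0_le_integral => //.
  - by do 2 apply: measurableT_comp => //; exact: measurable_funM md (mphi n).
  - by do 2 apply: measurableT_comp => //.
  - move=> x _; rewrite /= lee_fin normrM ler_piMr//.
    exact: approx_indic_bound.
move=> /(cvg_unique (@ereal_hausdorff R) (cvg_cst _)).
rewrite /= => h; rewrite /Rintegral (_ : (\int[mu]_(t in _) _)%E = 0%E)//.
rewrite h -[in LHS](setIidr sub) integral_mkcondr.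
apply: eq_integral => x _; rewrite /= /dab patchE indicE.
by case: ifPn => // _; rewrite ?mulr1 ?mulr0.
Qed.

(** The primitive of d is constant on ]0, T[, and its derivative is d almost
    everywhere by the Lebesgue differentiation theorem. *)
Lemma itv_integral0_ae T d : mu.-integrable `]0, T[ (EFin \o d) ->
  (forall a b, 0 < a -> b < T -> \int[mu]_(t in `]a, b[) d t = 0) ->
  ae_eq mu `]0, T[%classic d (cst 0).
Proof.
move=> id d0; pose e := d \_ `]0, T[.
have ie : mu.-integrable setT (EFin \o e).
  by rewrite -restrict_EFin; apply: (integrable_mkcond _ _).1 id.
have ieA A : measurable A -> mu.-integrable A (EFin \o e).
  by move=> mA; apply: integrableS ie.
have le : locally_integrable setT e by exact: integrable_locally.
have := FTC1Ny (fun y => ieA `]-oo, y]%classic (measurable_itv _)) le.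
apply: filterS; first exact: (ae_filter_ringOfSetsType mu).
move=> x [_ Fx] xT; move: (xT); rewrite /= in_itv/= => /andP[x0 xltT].
have <- : e x = d x by rewrite /e patchE mem_set.
pose F y := \int[mu]_(t in `]-oo, y]) e t.
rewrite -Fx -/F derive1E.
rewrite (@near_eq_derive _ _ _ _ (cst (F x)))//; first exact: derive_cst.
have Fmono y z : 0 < y -> z < T -> y <= z -> F y = F z.
  move=> y0 zT yz; apply/eqP; rewrite eq_sym -subr_eq0.
  rewrite Rintegral_itvB//=; last exact: ieA.
  rewrite -Rintegral_itv_bndo_bndc; last exact: ieA.
  rewrite -(d0 _ _ y0 zT); apply/eqP; apply: eq_Rintegral => t.
  rewrite inE/= in_itv/= => /andP[yt tz].
  rewrite /e patchE mem_set//= in_itv/= (lt_trans y0 yt)/=.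
  exact: lt_trans tz zT.
near=> y.
have y0 : 0 < y by near: y; exact: lt_nbhsr.
have yT : y < T by near: y; exact: lt_nbhsl.
by have [yx|/ltW xy] := leP y x; [exact: Fmono|apply/esym/Fmono].
Unshelve. all: by end_near. Qed.

End FundamentalLemma.

(** * Weak derivatives and the H^1 form *)

Section WeakDerivative.
Context {R : realType}.
Notation mu := (@lebesgue_measure R).
Implicit Types (T : R) (f g phi : R -> R) (v w : bool -> R -> R).

Lemma Rintegral_eq0 (D : set R) f : (forall t, D t -> f t = 0) ->
  \int[mu]_(t in D) f t = 0.
Proof.
by move=> f0; rewrite /Rintegral integral0_eq// => t Dt; rewrite f0.
Qed.

Lemma test_continuous T phi : test_function T phi -> continuous phi.
Proof.
move=> [dphi _ _] x; apply: differentiable_continuous.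
exact/derivable1_diffP.
Qed.

Lemma test_sqint T phi : 0 < T -> test_function T phi -> sqint `]0, T[ phi.
Proof.
move=> T0 /test_continuous cphi; apply: within_continuous_sqint => //.
exact: continuous_subspaceT.
Qed.

Lemma test_deriv_sqint T phi : 0 < T -> test_function T phi ->
  sqint `]0, T[ (derive1 phi).
Proof.
move=> T0 [_ cphi _]; apply: within_continuous_sqint => //.
exact: continuous_subspaceT.
Qed.

(** The difference integrates to zero against every test function.  Uniqueness
    makes the H^1 norm independent of the weak derivative that [weak_deriv]
    chooses. *)
Lemma weak_derivative_unique T f g g' : 0 < T ->
  weak_derivative T f g -> weak_derivative T f g' ->
  ae_eq mu `]0, T[%classic g g'.
Proof.
move=> T0 [Lg Hg] [Lg' Hg'].
have Ld : sqint `]0, T[ (fun t => -1 * g' t + g t) by exact: sqint_lin.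
have : ae_eq mu `]0, T[%classic (fun t => -1 * g' t + g t) (cst 0).
  apply: itv_integral0_ae; first exact: sqint_integrable.
  move=> a b a0 bT; apply: (test_integral_itv (sqint_integrable Ld)) => // phi tphi.
  have Lphi := test_sqint T0 tphi.
  transitivity (\int[mu]_(t in `]0, T[) (g t * phi t - g' t * phi t)).
    by apply: eq_Rintegral => t _; ring.
  rewrite RintegralB//; [|exact: sqintM|exact: sqintM].
  have := Hg _ tphi; rewrite (Hg' _ tphi) => /oppr_inj ->.
  exact: subrr.
apply: filterS => t h Dt; have := h Dt; rewrite mulN1r addrC => /eqP.
by rewrite subr_eq0 => /eqP.
Qed.

Lemma weak_derivative_lin T a f f' g g' : 0 < T ->
  sqint `]0, T[ f -> sqint `]0, T[ f' ->
  weak_derivative T f g -> weak_derivative T f' g' ->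
  weak_derivative T (fun t => a * f t + f' t) (fun t => a * g t + g' t).
Proof.
move=> T0 Lf Lf' [Lg Hg] [Lg' Hg']; split; first exact: sqint_lin.
move=> phi tphi.
have Lphi := test_sqint T0 tphi; have Ldphi := test_deriv_sqint T0 tphi.
have split u u' psi : sqint `]0, T[ u -> sqint `]0, T[ u' -> sqint `]0, T[ psi ->
    \int[mu]_(t in `]0, T[) ((a * u t + u' t) * psi t) =
    a * (\int[mu]_(t in `]0, T[) (u t * psi t)) +
    \int[mu]_(t in `]0, T[) (u' t * psi t).
  move=> Lu Lu' Lpsi.
  rewrite -RintegralZl//; last exact: sqintM.
  rewrite -RintegralD//=.
  - by apply: eq_Rintegral => t _; rewrite mulrDl mulrA.
  - rewrite (_ : _ \o _ = fun x => (a%:E * (u x * psi x)%:E)%E)//.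
    exact: integrableZl (sqintM _ Lu Lpsi).
  - exact: sqintM.
by rewrite !split// Hg// Hg'// opprD mulrN.
Qed.

Lemma H10_sqint T f : 0 < T -> H10 T f -> sqint `]0, T[ f.
Proof. by move=> T0 [cf _ _]; exact: within_continuous_sqint. Qed.

Lemma H10S_L2S T v : 0 < T -> H10S T v -> L2S T v.
Proof. by move=> T0 Hv b; exact: H10_sqint. Qed.

Lemma H10S_subspace T : 0 < T -> subspace (H10S T).
Proof.
move=> T0; split=> [b|a u v Hu Hv b].
  split => //; first by move=> x; exact: cst_continuous.
  exists (cst 0); split.
    exact: (L2S_subspace T).1 b.
  move=> phi _; rewrite !Rintegral_eq0 ?oppr0// => x _; exact: mul0r.
have [cu u0 [gu wu]] := Hu b; have [cv v0 [gv wv]] := Hv b.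
split.
- move=> x; apply: cvgD; last exact: cv.
  by apply: cvgM; [exact: cvg_cst|exact: cu].
- by rewrite -[LHS]/(a * u b 0 + v b 0) u0 v0 mulr0 addr0.
- exists (fun t => a * gu t + gv t).
  apply: weak_derivative_lin => //; exact: H10_sqint.
Qed.

Lemma weak_derivP T f : H10 T f -> weak_derivative T f (weak_deriv T f).
Proof. by move=> [_ _ wf]; exact: (xgetPex _ wf). Qed.

Lemma weak_deriv_ae T f g : 0 < T -> weak_derivative T f g ->
  ae_eq mu `]0, T[%classic (weak_deriv T f) g.
Proof.
move=> T0 wf; apply: (weak_derivative_unique T0 _ wf).
exact: (xgetI _ wf).
Qed.

Definition wderivS T v : bool -> R -> R := fun b => weak_deriv T (v b).

Definition H10S_ip T v w : R := L2S_ip T (wderivS T v) (wderivS T w).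

Lemma wderivS_L2S T v : H10S T v -> L2S T (wderivS T v).
Proof. by move=> Hv b; exact: (weak_derivP (Hv b)).1. Qed.

Lemma H10S_normE T v : H10S_norm T v = Num.sqrt (H10S_ip T v v).
Proof. by []. Qed.

Lemma H10S_norm_ge0 T v : 0 <= H10S_norm T v.
Proof. exact: sqrtr_ge0. Qed.

Lemma H10S_norm_sqr T v : H10S_norm T v ^+ 2 = H10S_ip T v v.
Proof. exact: L2S_norm_sqr. Qed.

(** The chosen weak derivatives depend linearly on the function only almost
    everywhere, which is enough under the integral. *)
Lemma H10S_form T : 0 < T -> psd_form (H10S T) (H10S_ip T).
Proof.
move=> T0; have hS := H10S_subspace T0; have [Bs Bl Bp] := L2S_form T; split.
- by move=> u v Hu Hv; apply: Bs; exact: wderivS_L2S.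
- move=> w Hw a u v Hu Hv.
  rewrite /H10S_ip -Bl; [|exact: wderivS_L2S..].
  apply: ae_L2S_ip; [exact/wderivS_L2S/hS.2| |exact: wderivS_L2S|].
    by apply: (L2S_subspace T).2; exact: wderivS_L2S.
  move=> b; apply: weak_deriv_ae => //.
  by apply: weak_derivative_lin => //;
    [exact: H10_sqint|exact: H10_sqint|exact: weak_derivP|exact: weak_derivP].
- by move=> u Hu; apply: Bp; exact: wderivS_L2S.
Qed.

End WeakDerivative.

(** * Piecewise affine functions *)

Section PiecewiseAffine.
Context {R : realType}.
Notation mu := (@lebesgue_measure R).
Implicit Types (x y z T p q : R) (s : seq R) (f phi : R -> R) (e : R * R).

Definition elements x s : seq (R * R) := zip (x :: s) s.

Definition affine_on e f :=
  exists p q : R, forall t, e.1 < t < e.2 -> f t = p + q * t.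

Lemma last_ge x s : path <%R x s -> x <= last x s.
Proof.
elim: s x => //= y s IH x /andP[xy /IH]; exact: le_trans (ltW xy).
Qed.

Lemma elements_bounds x s e : path <%R x s -> e \in elements x s ->
  [/\ x <= e.1, e.1 < e.2 & e.2 <= last x s].
Proof.
elim: s x => [//|y s IH] x /= /andP[xy ys].
rewrite in_cons => /predU1P[->|/(IH _ ys)[h1 h2 h3]] /=; last first.
  by split => //; exact: le_trans (ltW xy) h1.
by split => //; exact: last_ge.
Qed.

(** A point inside one element cannot lie in another one, not even at an
    endpoint. *)
Lemma elements_unique x s e e' m : path <%R x s ->
  e \in elements x s -> e' \in elements x s ->
  e.1 < m < e.2 -> e'.1 <= m <= e'.2 -> e = e'.
Proof.
elim: s x => [//|y s IH] x /= /andP[xy ys].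
rewrite !in_cons => /predU1P[->|he] /predU1P[->|he'] //=.
- move=> /andP[_ my] /andP[ym _].
  have [h _ _] := elements_bounds ys he'.
  by have := lt_le_trans my (le_trans h ym); rewrite ltxx.
- move=> /andP[em _] /andP[_ my].
  have [h _ _] := elements_bounds ys he.
  by have := lt_le_trans em (le_trans my h); rewrite ltxx.
- exact: IH ys he he'.
Qed.

Lemma affine_on_closed x y p q f : x < y -> {within `[x, y], continuous f} ->
  (forall t, x < t < y -> f t = p + q * t) ->
  forall t, x <= t <= y -> f t = p + q * t.
Proof.
move=> xy /(continuous_within_itvP _ xy)[_ cx cy] fE.
have ca : continuous (fun t => p + q * t).
  move=> t; apply: cvgD; first exact: cvg_cst.
  by apply: cvgM; [exact: cvg_cst|exact: cvg_id].
have fx : f x = p + q * x.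
  apply: (cvg_unique _ cx); first exact: Rhausdorff.
  apply: cvg_trans (cvg_at_right_filter (ca x)).
  apply: near_eq_cvg; near=> t; rewrite fE//; apply/andP; split.
    by near: t; exact: nbhs_right_gt.
  by near: t; exact: nbhs_right_lt.
have fy : f y = p + q * y.
  apply: (cvg_unique _ cy); first exact: Rhausdorff.
  apply: cvg_trans (cvg_at_left_filter (ca y)).
  apply: near_eq_cvg; near=> t; rewrite fE//; apply/andP; split.
    by near: t; exact: nbhs_left_gt.
  by near: t; exact: nbhs_left_lt.
move=> t /andP[]; rewrite !le_eqVlt => /predU1P[<-//|xt] /predU1P[->//|ty].
by apply: fE; rewrite xt.
Unshelve. all: by end_near. Qed.

Lemma derive1_affine x y p q f : (forall t, x < t < y -> f t = p + q * t) ->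
  forall t, x < t < y -> is_derive t 1 f q.
Proof.
move=> fE t /andP[xt ty].
have da : is_derive t 1 (cst p + (cst q * (id : R -> R))) q.
  by apply: is_derive_eq; rewrite /= /GRing.scale/= mulr1 mulr0 addr0 add0r.
apply: near_eq_is_derive da; near=> u; rewrite fE//; apply/andP; split.
- by near: u; exact: lt_nbhsr.
- by near: u; exact: lt_nbhsl.
Unshelve. all: by end_near. Qed.

Lemma sqint_set1 y f : sqint [set y] f.
Proof.
apply: (@sqint_bounded _ _ _ `|f y|) => //.
- by rewrite lebesgue_measure_set1.
- exact: measurable_fun_set1.
- by move=> t ->.
Qed.

Lemma itv_ocE x y : x < y -> `]x, y]%classic = `]x, y[%classic `|` [set y].
Proof. by move=> xy; rewrite setUitv1//= bnd_simp. Qed.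

End PiecewiseAffine.

Section ByParts.
Context {R : realType}.
Notation mu := (@lebesgue_measure R).
Implicit Types (x y z T p q : R) (s : seq R) (f phi : R -> R) (e : R * R).

Definition C1 phi := (forall t, derivable phi t 1) /\ continuous (derive1 phi).

Lemma C1_continuous phi : C1 phi -> continuous phi.
Proof.
move=> [dphi _] t; apply: differentiable_continuous; exact/derivable1_diffP.
Qed.

Lemma affine_deriv_sqint x y p q f : x < y ->
  (forall t, x < t < y -> f t = p + q * t) -> sqint `]x, y] (derive1 f).
Proof.
move=> xy fE; rewrite itv_ocE//; apply: sqintU.
- apply/disj_setPS => t [/= h ty]; move: h; by rewrite ty in_itv/= ltxx andbF.
- apply: (@eq_sqint _ _ (cst q : R -> R)).
    move=> t; rewrite inE/= in_itv/= => xty; rewrite derive1E.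
    by have [_ ->] := derive1_affine fE xty.
  apply: (@sqint_bounded _ _ _ `|q|) => //; exact: lebesgue_itv_lty.
- exact: sqint_set1.
Qed.

Lemma by_parts_integrable x y f phi :
  {within `[x, y], continuous f} -> sqint `]x, y] (derive1 f) -> C1 phi ->
  mu.-integrable `]x, y]
    (EFin \o (fun t => f t * derive1 phi t + derive1 f t * phi t)).
Proof.
move=> cf sdf hphi.
have sub : `]x, y] `<=` `[x, y] by apply: subset_itv; rewrite bnd_simp.
have cs g : {within `[x, y], continuous g} -> sqint `]x, y] g.
  by move=> /within_continuous_sqint_cc; exact: sqint_sub.
have i1 : mu.-integrable `]x, y] (EFin \o (fun t => f t * derive1 phi t)).
  by apply: sqintM => //; apply: cs => //; exact/continuous_subspaceT/hphi.2.
have i2 : mu.-integrable `]x, y] (EFin \o (fun t => derive1 f t * phi t)).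
  apply: sqintM => //; apply: cs; apply: continuous_subspaceT.
  exact: C1_continuous.
by have := integrableD _ i1 i2; exact.
Qed.

(** Half-open intervals ]x, y] are used so that consecutive elements are
    disjoint and their union is again of this kind. *)
Lemma affine_by_parts x y p q f phi : x < y ->
  {within `[x, y], continuous f} -> (forall t, x < t < y -> f t = p + q * t) ->
  C1 phi ->
  \int[mu]_(t in `]x, y]) (f t * derive1 phi t + derive1 f t * phi t) =
  f y * phi y - f x * phi x.
Proof.
move=> xy cf fE hphi.
(* continuity makes f affine up to the endpoints as well *)
have fE' := affine_on_closed xy cf fE.
have intf := by_parts_integrable cf (affine_deriv_sqint xy fE) hphi.
have sub : `]x, y[ `<=` `]x, y] by apply: subset_itv; rewrite bnd_simp.
rewrite -Rintegral_itv_bndo_bndc; last exact: integrableS intf.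
(* G is continuous, unlike the integrand at the endpoints, and has primitive f phi *)
pose G t := (p + q * t) * derive1 phi t + q * phi t.
have cG : continuous G.
  move=> t; apply: cvgD.
    apply: cvgM; last exact: hphi.2.
    apply: cvgD; first exact: cvg_cst.
    by apply: cvgM; [exact: cvg_cst|exact: cvg_id].
  by apply: cvgM; [exact: cvg_cst|exact: C1_continuous].
have iG : mu.-integrable `[x, y] (EFin \o G).
  apply: continuous_compact_integrable; first exact: segment_compact.
  exact: continuous_subspaceT.
transitivity (\int[mu]_(t in `]x, y[) G t).
  apply: eq_Rintegral => t; rewrite inE/= in_itv/= => xty.
  rewrite (derive1E f); have [_ ->] := derive1_affine fE xty.
  by rewrite /G fE.
rewrite Rintegral_itv_bndo_bndc; last first.
  by apply: integrableS iG => //; apply: subset_itv; rewrite bnd_simp.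
rewrite Rintegral_itv_obnd_cbnd; last first.
  by apply: integrableS iG => //; apply: subset_itv; rewrite bnd_simp.
pose F : R -> R := (cst p + (cst q * (id : R -> R))) * phi.
have dF (t : R) : is_derive t 1 F (G t).
  have dphi : is_derive t 1 phi (derive1 phi t).
    by rewrite derive1E; apply/derivableP/hphi.1.
  apply: is_derive_eq; rewrite /G /= !fctE /GRing.scale/=.
  by ring.
have FE t : x <= t <= y -> f t * phi t = F t.
  by move=> xty; rewrite fE'.
rewrite !FE ?lexx ?ltW//.
rewrite /Rintegral (@continuous_FTC2 _ G F)//.
- exact: continuous_subspaceT.
- have cF : continuous F.
    move=> t; apply: differentiable_continuous; apply/derivable1_diffP.
    by have [] := dF t.
  split=> [t _| |].
  + by have [] := dF t.
  + by apply: cvg_at_right_filter; exact: cF.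
  + by apply: cvg_at_left_filter; exact: cF.
- by move=> t _; rewrite derive1E; have [_ ->] := dF t.
Qed.

(** The boundary terms of consecutive elements cancel because f is
    continuous. *)
Lemma pl_by_parts x s f : path <%R x s ->
  {within `[x, last x s], continuous f} ->
  (forall e, e \in elements x s -> affine_on e f) ->
  sqint `]x, last x s] (derive1 f) /\
  forall phi, C1 phi ->
  \int[mu]_(t in `]x, last x s]) (f t * derive1 phi t + derive1 f t * phi t) =
  f (last x s) * phi (last x s) - f x * phi x.
Proof.
elim: s x => [|y s IH] x /=.
  move=> _ _ _; rewrite set_itvoc0; split; first exact: sqint_set0.
  by move=> phi _; rewrite Rintegral_set0 subrr.
move=> /andP[xy ys] cf aff.
have yz := last_ge ys.
have [sdf2 H2] : sqint `]y, last y s] (derive1 f) /\ forall phi, C1 phi ->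
    \int[mu]_(t in `]y, last y s]) (f t * derive1 phi t + derive1 f t * phi t) =
    f (last y s) * phi (last y s) - f y * phi y.
  apply: IH => //.
    apply: continuous_subspaceW cf; apply: subset_itvr.
    by rewrite bnd_simp ltW.
  by move=> e he; apply: aff; rewrite in_cons he orbT.
have [p [q fE]] := aff (x, y) (mem_head _ _).
have cxy : {within `[x, y], continuous f}.
  by apply: continuous_subspaceW cf; apply: subset_itvl; rewrite bnd_simp.
have sdf1 := affine_deriv_sqint xy fE.
have disj : [disjoint `]x, y]%classic & `]y, last y s]%classic].
  apply/disj_setPS => t [/=]; rewrite !in_itv/= => /andP[_ ty] /andP[yt _].
  by have := lt_le_trans yt ty; rewrite ltxx.
have splitE : `]x, last y s]%classic = `]x, y] `|` `]y, last y s].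
  by rewrite -itv_bndbnd_setU// bnd_simp ltW.
have sdf : sqint `]x, last y s] (derive1 f) by rewrite splitE; exact: sqintU.
split=> // phi hphi.
have := by_parts_integrable cf sdf hphi; rewrite splitE => intf.
rewrite Rintegral_setU// (affine_by_parts xy cxy fE hphi) H2//.
by rewrite addrC addrA subrK.
Qed.

(** At the nodes the classical derivative has junk values, but the nodes form
    a null set. *)
Lemma pl_weak_derivative T s f : 0 < T -> itv_partition 0 T s ->
  {within `[0, T], continuous f} ->
  (forall e, e \in elements 0 s -> affine_on e f) ->
  weak_derivative T f (derive1 f).
Proof.
move=> T0 [ps /eqP lastT] cf aff.
have [||sdf H] := @pl_by_parts 0 s f ps; rewrite ?lastT//.
rewrite lastT in sdf H.
have sub : `]0, T[ `<=` `]0, T] by apply: subset_itv; rewrite bnd_simp.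
have sdf' : sqint `]0, T[ (derive1 f) by exact: sqint_sub sdf.
split=> // phi tphi; have [d1 d2 [a [b [a0 bT supp]]]] := tphi.
have hphi : C1 phi by [].
have phi0 : phi 0 = 0.
  by apply: contraTeq a0 => /supp/andP[]; rewrite -leNgt.
have phiT : phi T = 0.
  by apply: contraTeq bT => /supp/andP[_]; rewrite -leNgt.
have := H _ hphi; rewrite phi0 phiT !mulr0 subrr.
rewrite -Rintegral_itv_bndo_bndc; last first.
  by apply: integrableS (by_parts_integrable cf sdf hphi).
rewrite RintegralD//=.
- by move=> /eqP; rewrite addr_eq0 => /eqP.
- apply: sqintM => //; last exact: test_deriv_sqint.
  exact: within_continuous_sqint.
- by apply: sqintM => //; exact: test_sqint.
Qed.

Lemma pl_zero x s f : path <%R x s -> {within `[x, last x s], continuous f} ->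
  (forall e, e \in elements x s -> affine_on e f) ->
  f x = 0 -> (forall y, y \in s -> f y = 0) ->
  forall t, x <= t <= last x s -> f t = 0.
Proof.
elim: s x => [|y s IH] x /=.
  by move=> _ _ _ fx0 _ t; rewrite -eq_le => /eqP <-.
move=> /andP[xy ys] cf aff fx0 fs0 t /andP[xt tz].
have fy0 : f y = 0 by apply: fs0; exact: mem_head.
have [ty|/ltW yt] := leP t y; last first.
  apply: (IH y) => //; last by rewrite yt.
  - apply: continuous_subspaceW cf; apply: subset_itvr.
    by rewrite bnd_simp ltW.
  - by move=> e he; apply: aff; rewrite in_cons he orbT.
  - by move=> u us; apply: fs0; rewrite in_cons us orbT.
have [p [q fE]] := aff (x, y) (mem_head _ _).
have cxy : {within `[x, y], continuous f}.
  apply: continuous_subspaceW cf; apply: subset_itvl.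
  by rewrite bnd_simp last_ge.
have fE' := affine_on_closed xy cxy fE.
have := fE' x; rewrite lexx ltW// fx0 => /(_ isT) ex.
have := fE' y; rewrite lexx ltW// fy0 => /(_ isT) ey.
have /eqP : q * (y - x) = 0 by lra.
rewrite mulf_eq0 subr_eq0 (gt_eqF xy) orbF => /eqP q0.
have -> : f t = p + q * t by apply: fE'; rewrite xt.
by rewrite ex q0 !mul0r.
Qed.

End ByParts.

(** * The spline space *)

Section SplineSpace.
Context {R : realType}.
Notation mu := (@lebesgue_measure R).
Implicit Types (T : R) (M : bool -> seq R) (v w z : bool -> R -> R).

Lemma S1_subspace T M : subspace (S1 T M).
Proof.
split=> [b|a u v Su Sv b].
  split=> // [x|e _]; first exact: cst_continuous.
  by exists 0, 0 => t _; rewrite mul0r addr0.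
have [cu u0 au] := Su b; have [cv v0 av] := Sv b; split.
- move=> x; apply: cvgD; last exact: cv.
  by apply: cvgM; [exact: cvg_cst|exact: cu].
- by rewrite -[LHS]/(a * u b 0 + v b 0) u0 v0 mulr0 addr0.
- move=> e he; have [p [q uE]] := au e he; have [p' [q' vE]] := av e he.
  exists (a * p + p'), (a * q + q') => t te.
  rewrite -[LHS]/(a * u b t + v b t) uE// vE//; ring.
Qed.

Lemma S1_weak_derivative T M v b : 0 < T -> is_mesh T M -> S1 T M v ->
  weak_derivative T (v b) (derive1 (v b)).
Proof.
by move=> T0 hM Sv; have [cv _ av] := Sv b; exact: pl_weak_derivative (hM b) _ _.
Qed.

Lemma S1_H10S T M v : 0 < T -> is_mesh T M -> S1 T M v -> H10S T v.
Proof.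
move=> T0 hM Sv b; have [cv v0 _] := Sv b; split=> //.
by exists (derive1 (v b)); exact: S1_weak_derivative Sv.
Qed.

Lemma S1_L2S T M v : 0 < T -> is_mesh T M -> S1 T M v -> L2S T v.
Proof. by move=> T0 hM Sv; apply: H10S_L2S => //; exact: S1_H10S Sv. Qed.

Lemma mem_List_In (A : eqType) (y : A) (s : seq A) : y \in s -> List.In y s.
Proof.
elim: s => // x s IH; rewrite in_cons => /predU1P[->|/IH]; first by left.
by right.
Qed.

(** Nodal values separate splines; they provide the finitely many functionals
    asked for by [riesz_finite]. *)
Definition node_values M : seq ((bool -> R -> R) -> R) :=
  List.app (List.map (fun y v => v false y) (M false))
           (List.map (fun y v => v true y) (M true)).

Lemma node_values_linear M l : List.In l (node_values M) ->
  linear_on (fun _ => True) l.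
Proof.
move=> h; have [{}h|{}h] := List.in_app_or _ _ _ h;
  by have [y [<- _]] := (List.in_map_iff _ _ _).1 h; move=> a u v _ _.
Qed.

Lemma S1_node_values0 T M z : is_mesh T M -> S1 T M z ->
  (forall l, List.In l (node_values M) -> l z = 0) ->
  forall b, {in `[0, T], z b =1 cst 0}.
Proof.
move=> hM Sz lz b t; rewrite in_itv => t0T.
have [cz z0 az] := Sz b; have [ps /eqP lastT] := hM b.
apply: (pl_zero ps _ az z0); rewrite ?lastT//.
move=> y yM; case: b {cz z0 az ps lastT} yM => yM.
- apply: (lz (fun v => v true y)); apply: List.in_or_app; right.
  by apply/List.in_map_iff; exists y; split => //; exact: mem_List_In.
- apply: (lz (fun v => v false y)); apply: List.in_or_app; left.
  by apply/List.in_map_iff; exists y; split => //; exact: mem_List_In.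
Qed.

Lemma S1_riesz T M B F : is_mesh T M ->
  psd_form (S1 T M) B ->
  (forall z, S1 T M z -> (forall b, {in `[0, T], z b =1 cst 0}) -> B z z = 0) ->
  linear_on (S1 T M) F -> (forall z, S1 T M z -> B z z = 0 -> F z = 0) ->
  exists2 v, S1 T M v & forall z, S1 T M z -> B v z = F z.
Proof.
move=> hM hB B0 linF nullF.
apply: (riesz_finite (ls := node_values M)) => //; first exact: S1_subspace.
- by move=> l /node_values_linear; exact: linear_on_sub.
- by move=> z Sz lz; apply: B0 => //; exact: S1_node_values0 lz.
Qed.

Lemma L2S_ip_zero T z : (forall b, {in `[0, T], z b =1 cst 0}) ->
  L2S_ip T z z = 0.
Proof.
move=> z0; apply: big1 => b _; apply: Rintegral_eq0 => t Dt.
by rewrite z0 ?mul0r//; exact: subset_itvW Dt.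
Qed.

(** Existence of the projection: without it the operator would be the default
    value zero and its stability would carry no information. *)
Lemma Q0P T M w : 0 < T -> is_mesh T M -> L2S T w ->
  L2_projection_rel T M w (Q0 T M w).
Proof.
move=> T0 hM Lw; apply: xgetPex.
have SL v : S1 T M v -> L2S T v by exact: S1_L2S.
have hL := L2S_subspace T; have hB := L2S_form T.
have [||||q Sq qE] := @S1_riesz T M (L2S_ip T) (L2S_ip T w) hM.
- exact: psd_form_sub hB.
- by move=> z _; exact: L2S_ip_zero.
- exact: linear_on_sub SL (psd_formr hB hL Lw).
- by move=> z /SL Lz; exact: psd_form_null hL hB Lw Lz.
exists q; split => // z Sz.
have [_ Bl _] := hB; rewrite (linear_onB hL (Bl _ (SL _ Sz)))//.
  by rewrite qE// subrr.
exact: SL.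
Qed.

End SplineSpace.

(** * The delay operator *)

Section Delay.
Context {R : realType}.
Notation mu := (@lebesgue_measure R).
Implicit Types (T L : R) (f g h : R -> R) (v w : bool -> R -> R).

Lemma lebesgue_measure_translate L (A : set R) : measurable A ->
  pushforward mu ((fun x => x - L) : _ -> measurableTypeR R) A = mu A.
Proof.
move=> mA; apply/esym/lebesgue_measure_unique => //=.
  exact: measurable_funB.
move=> _ _ [[a b]] _ <-.
rewrite /pushforward (_ : _ @^-1` _ = `](a + L), (b + L)]%classic).
  rewrite !lebesgue_measure_itv/= !lte_fin ltrD2r -!EFinB.
  by rewrite (_ : b + L - (a + L) = b - a)//; ring.
by apply/seteqP; split => x /=; rewrite !in_itv/= ltrBrDr lerBlDr.
Qed.

Lemma ge0_integral_translate L (f : R -> \bar R) :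
  measurable_fun [set: R] f -> (forall r, 0 <= f r)%E ->
  (\int[mu]_r f (r - L)%R = \int[mu]_r f r)%E.
Proof.
move=> mf f0.
have mt : measurable_fun [set: measurableTypeR R]
    ((fun x => x - L) : measurableTypeR R -> measurableTypeR R).
  exact: measurable_funB.
have := @ge0_integral_pushforward _ _ _ _ R _ mt mu setT f measurableT mf.
rewrite preimage_setT => <-//.
by apply: eq_measure_integral => //= A mA AS; exact: lebesgue_measure_translate.
Qed.

(** The double layer operator is -1/2 times this one; without the factor it is
    a contraction which commutes with differentiation off t = L. *)
Definition delay L v : bool -> R -> R :=
  fun b t => if t - L <= 0 then 0 else v (~~ b) (t - L).

(** The part of g on ]T - L, T[ is shifted out of ]0, T[, hence an inequality
    only.  The hypothesis is only required almost everywhere because a delayed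
    spline may have a kink at t = L. *)
Lemma sqr_integral_translate_le T L g h : sqint `]0, T[ g -> sqint `]0, T[ h ->
  0 < L ->
  ae_eq mu `]0, T[%classic h (fun t => if t - L <= 0 then 0 else g (t - L)) ->
  \int[mu]_(t in `]0, T[) (h t * h t) <= \int[mu]_(t in `]0, T[) (g t * g t).
Proof.
move=> sg sh L0 hg; pose e := g \_ `]0, T[; pose F x := ((e x) ^+ 2)%:E.
have me : measurable_fun setT e.
  by apply/(measurable_restrictT _ _).1 => //; exact: sqint_meas.
have mF : measurable_fun setT F by apply/measurable_EFinP; exact: measurable_funX.
have F0 x : (0 <= F x)%E by rewrite lee_fin sqr_ge0.
have mFL : measurable_fun setT (fun x : R => F (x - L)).
  by apply: measurableT_comp => //; exact: measurable_funB.
have mh : measurable_fun `]0, T[ h by exact: sqint_meas.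
have finh := sqintM (measurable_itv _) sh sh.
have fing := sqintM (measurable_itv _) sg sg.
rewrite /Rintegral fine_le//.
- exact: integrable_fin_num.
- exact: integrable_fin_num.
apply: (@le_trans _ _ (\int[mu]_(x in `]0%R, T[) F (x - L)%R)%E).
  rewrite le_eqVlt; apply/orP; left; apply/eqP.
  apply: ge0_ae_eq_integral => //.
  - by apply/measurable_EFinP; exact: measurable_funM.
  - exact: measurable_funTS.
  - by move=> x _; rewrite lee_fin -expr2 sqr_ge0.
  - move: hg; apply: filterS => x hx Dx; rewrite hx// -expr2 /F /e patchE.
    move: Dx; rewrite /= in_itv/= => /andP[x0 xT].
    case: ifPn => [xL|]; last first.
      rewrite -ltNge => xL; rewrite mem_set//= in_itv/= xL/=.
      by rewrite (lt_trans _ xT)// ltrBlDr ltrDl.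
    by rewrite memNset//= in_itv/= ltNge xL.
apply: (@le_trans _ _ (\int[mu]_x F (x - L)%R)%E).
  by apply: ge0_subset_integral => //.
rewrite ge0_integral_translate// [leRHS]integral_mkcond le_eqVlt.
apply/orP; left; apply/eqP; apply: eq_integral => x _.
by rewrite /F /e !patchE; case: ifPn => // _; rewrite expr0n.
Qed.

Lemma delay_norm_le T L v w : L2S T v -> L2S T w -> 0 < L ->
  (forall b, ae_eq mu `]0, T[%classic (w b) (delay L v b)) ->
  L2S_norm T w <= L2S_norm T v.
Proof.
move=> Lv Lw L0 wv; rewrite ler_sqrt ?L2S_ip_ge0//.
rewrite /L2S_ip [leRHS](reindex_inj (can_inj negbK))/=.
apply: ler_sum => b _.
exact: sqr_integral_translate_le (Lv (~~ b)) (Lw b) L0 (wv b).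
Qed.

(** As f vanishes at 0, the case distinction is a composition with a
    continuous function. *)
Lemma delayE L f t : f 0 = 0 ->
  (if t - L <= 0 then 0 else f (t - L)) = f (Num.max (t - L) 0).
Proof. by move=> f0; case: leP => // _; rewrite f0. Qed.

Lemma delay_continuous T L f : 0 < L -> f 0 = 0 ->
  {within `[0, T], continuous f} ->
  {within `[0, T], continuous (fun t => if t - L <= 0 then 0 else f (t - L))}.
Proof.
move=> L0 f0 /subspace_continuousP cf; apply/subspace_continuousP => x x0T.
pose m t := Num.max (t - L) 0.
have m0T t : `[0, T]%classic t -> `[0, T]%classic (m t).
  rewrite /= !in_itv/= => /andP[t0 tT]; rewrite /m le_max lexx orbT/=.
  by rewrite ge_max (le_trans t0 tT) andbT (le_trans _ tT)// lerBlDr lerDl ltW.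
have cm : continuous m.
  move=> t; apply: (@continuous_comp _ _ _ (fun t => t - L) (Num.max ^~ 0)).
    by apply: cvgB; [exact: cvg_id|exact: cvg_cst].
  exact: continuous_pos_part.
rewrite (_ : (fun t => _) = f \o m); last first.
  by apply/funext => t; rewrite delayE.
move=> P /(cf _ (m0T _ x0T)) /= h0.
have h1 : nbhs x (m @^-1` _) := cm x _ h0.
apply: filterS h1 => t h /m0T.
exact: h.
Qed.

Lemma derive1_translate L f t :
  derive1 (fun u => f (u - L)) t = derive1 f (t - L).
Proof.
rewrite /derive1 (_ : (fun h : R => h^-1 *: (f (h + t - L) - f (t - L))) =
  (fun h : R => h^-1 *: (f (h + (t - L)) - f (t - L))))//.
by apply/funext => h; rewrite addrA.
Qed.

Lemma derive1_delay L v b t : t != L ->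
  derive1 (delay L v b) t = delay L (fun b => derive1 (v b)) b t.
Proof.
rewrite /delay neq_lt => /orP[tL|Lt].
  rewrite ifT ?subr_le0 ?ltW// derive1E.
  rewrite (@near_eq_derive _ _ _ _ (cst 0)) ?derive_cst//.
  near=> u; rewrite ifT// subr_le0 ltW//.
  by near: u; exact: lt_nbhsl.
rewrite ifF ?leNgt ?subr_gt0 ?Lt// -derive1_translate !derive1E.
apply: near_eq_derive; near=> u; rewrite ifF//.
apply/negbTE; rewrite -ltNge subr_gt0.
by near: u; exact: lt_nbhsr.
Unshelve. all: by end_near. Qed.

End Delay.

(** * Delay and Neumann sums on the spline space *)

Section DelayOnSplines.
Context {R : realType}.
Notation mu := (@lebesgue_measure R).
Implicit Types (T L : R) (M : bool -> seq R) (v w z : bool -> R -> R).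

Lemma slice_cover L n (x : R) : 0 < L -> (0 < n)%N -> 0 <= x <= n%:R * L ->
  exists2 j, (j < n)%N & j%:R * L <= x <= j.+1%:R * L.
Proof.
move=> L0; elim: n => // n IH _ /andP[x0 xn].
have [xle|xgt] := leP x (n%:R * L); last first.
  by exists n => //; rewrite (ltW xgt) xn.
have [n0|n0] := posnP n.
  by exists 0%N => //; rewrite mul0r x0/=; move: xn; rewrite n0.
have [|j jn jx] := IH n0; first by rewrite x0.
by exists j => //; exact: ltnW.
Qed.

(** The midpoint of an element lies in some slice, hence in an element of that
    slice, which has to be the given one. *)
Lemma element_in_slice L n M b e : 0 < L -> (0 < n)%N ->
  is_mesh (n%:R * L) M -> slice_matching L n M -> e \in mesh_elements (M b) ->
  exists2 j, (j < n)%N & slice_elements L (M b) j e.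
Proof.
move=> L0 n0 hM [hcover _] he.
have [ps /eqP lastT] := hM b.
have [e0 e12 eT] := elements_bounds ps he; rewrite lastT in eT.
pose m := (e.1 + e.2) / 2.
have em : e.1 < m < e.2 by apply/andP; split; rewrite /m; lra.
have [|j jn jm] := @slice_cover L n m L0 n0.
  move: em => /andP[em1 em2].
  by rewrite (le_trans e0 (ltW em1)) (le_trans (ltW em2) eT).
exists j => //.
have : [set` `[j%:R * L, j.+1%:R * L]] m by rewrite /= in_itv.
rewrite (hcover b j jn) => -[e' he' me']; have [e'M _ _] := he'.
by rewrite (elements_unique ps he e'M em _).
Qed.

(** Elements of the first slice see the value zero; an element of a
    later slice is the translate by L of an element of the other
    boundary component. *)
Lemma delay_S1 L n M v : 0 < L -> (0 < n)%N -> is_mesh (n%:R * L) M ->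
  slice_matching L n M -> S1 (n%:R * L) M v -> S1 (n%:R * L) M (delay L v).
Proof.
move=> L0 n0 hM hmatch Sv b; have [cv v0 av] := Sv (~~ b); split.
- exact: delay_continuous.
- by rewrite /delay ifT// sub0r oppr_le0 ltW.
- move=> e he; have [j jn sje] := element_in_slice L0 n0 hM hmatch he.
  case: j jn sje => [_ [_ _ eL]|j jn].
    exists 0, 0 => t /andP[_ te]; rewrite mul0r addr0 /delay ifT// subr_le0.
    by apply/ltW/(lt_le_trans te); move: eL; rewrite mul1r.
  rewrite -{1}(negbK b) hmatch.2// => -[e' [he' e'1 _] <-]/=.
  have [p [q vE]] := av e' he'.
  exists (p - q * L), q => t /andP[t1 t2]; rewrite /delay ifF; last first.
    apply/negbTE; rewrite -ltNge subr_gt0 (le_lt_trans _ t1)// lerDr.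
    by rewrite (le_trans _ e'1)// mulr_ge0// ltW.
  by rewrite vE; [ring|rewrite ltrBrDr t1 ltrBlDr].
Qed.

Lemma delay_L2S_norm_le T L M v : 0 < T -> 0 < L -> is_mesh T M -> S1 T M v ->
  S1 T M (delay L v) -> L2S_norm T (delay L v) <= L2S_norm T v.
Proof.
move=> T0 L0 hM Sv SKv; apply: (@delay_norm_le _ T L) => //; [exact: S1_L2S Sv| |].
  exact: S1_L2S SKv.
by move=> b; exact: ae_eq_refl.
Qed.

Lemma S1_wderivS T M v b : 0 < T -> is_mesh T M -> S1 T M v ->
  ae_eq mu `]0, T[%classic (wderivS T v b) (derive1 (v b)).
Proof. by move=> T0 hM Sv; apply: weak_deriv_ae => //; exact: S1_weak_derivative Sv. Qed.

Lemma S1_H10S_norm T M v : 0 < T -> is_mesh T M -> S1 T M v ->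
  H10S_norm T v = L2S_norm T (fun b => derive1 (v b)).
Proof.
move=> T0 hM Sv; congr Num.sqrt.
have Lw : L2S T (wderivS T v) by apply: wderivS_L2S; exact: S1_H10S Sv.
have Ld : L2S T (fun b => derive1 (v b)).
  by move=> b; have [] := S1_weak_derivative b T0 hM Sv.
have E b := S1_wderivS b T0 hM Sv.
rewrite -/(wderivS T v) (ae_L2S_ip Lw Ld Lw E).
have [Bs _ _] := L2S_form T.
by rewrite (Bs _ _ Ld Lw); exact: (ae_L2S_ip Lw Ld Ld E).
Qed.

Lemma delay_H10S_norm_le T L M v : 0 < T -> 0 < L -> is_mesh T M -> S1 T M v ->
  S1 T M (delay L v) -> H10S_norm T (delay L v) <= H10S_norm T v.
Proof.
move=> T0 L0 hM Sv SKv; rewrite (S1_H10S_norm T0 hM SKv) (S1_H10S_norm T0 hM Sv).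
apply: (@delay_norm_le _ T L) => //.
- by move=> b; have [] := S1_weak_derivative b T0 hM Sv.
- by move=> b; have [] := S1_weak_derivative b T0 hM SKv.
move=> b; exists [set L]; split => //; first exact: lebesgue_measure_set1.
move=> t /= ht; apply: contrapT => /eqP tL; apply: ht => _.
exact: derive1_delay.
Qed.

(** Iterates of z |-> 2 s (v + delay z / 2), where s = 1 or -1 is the sign in
    A.  A fixed point is a solution z of A z = v; started at 0, the k-th
    iterate is the k-th partial Neumann sum. *)
Definition neumann (s : bool) L k v z :=
  iter k (fun z => (2 * (-1) ^+ s) *: v + (-1) ^+ s *: delay L z) z.

Lemma neumann_fixed s L k w : neumann s L k (half_id_double_layer s L w) w = w.
Proof.
elim: k => //= k ->; apply/funext => b; apply/funext => t.
rewrite -[LHS]/(2 * (-1) ^+ s * (half_id_double_layer s L w b t) +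
  (-1) ^+ s * delay L w b t).
rewrite /half_id_double_layer /double_layer -/(delay L w b t).
by case: s; rewrite ?expr1 ?expr0; field.
Qed.

Lemma delay_lin L a u v : delay L (a *: u + v) = a *: delay L u + delay L v.
Proof.
apply/funext => b; apply/funext => t.
rewrite -[RHS]/(a * delay L u b t + delay L v b t) /delay.
by case: ifP => // _; rewrite mulr0 addr0.
Qed.

Lemma delayB L u v : delay L (u - v) = delay L u - delay L v.
Proof. by rewrite -(addrC (- v)) -scaleN1r delay_lin scaleN1r addrC. Qed.

Lemma neumannB s L k u v y z :
  neumann s L k (u - v) (y - z) = neumann s L k u y - neumann s L k v z.
Proof.
elim: k => //= k ->; rewrite delayB !scalerBr opprD.
by rewrite [RHS]addrACA.
Qed.

(** The starting point is delayed k times, so it is not seen before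
    time k L. *)
Lemma neumann_start s L k v y z b t : 0 < t <= k%:R * L ->
  neumann s L k v y b t = neumann s L k v z b t.
Proof.
elim: k b t => [|k IH] b t /andP[t0 tk].
  by move: tk; rewrite mul0r leNgt t0.
rewrite /= -[LHS]/(_ * v b t + _ * delay L (neumann s L k v y) b t).
rewrite -[RHS]/(_ * v b t + _ * delay L (neumann s L k v z) b t) /delay.
case: leP => // tL; rewrite IH// tL/= lerBlDr.
by move: tk; rewrite -natr1 mulrDl mul1r.
Qed.

Lemma neumann_sub s L k v z (S : (bool -> R -> R) -> Prop) : subspace S ->
  (forall y, S y -> S (delay L y)) -> S v -> S z -> S (neumann s L k v z).
Proof.
move=> hS Sd Sv Sz; elim: k => //= k Sk; apply: hS.2 => //.
by apply: subspaceZ => //; exact: Sd.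
Qed.

Lemma neumann_norm_le s L k v (S : (bool -> R -> R) -> Prop) B :
  subspace S -> psd_form S B -> (forall y, S y -> S (delay L y)) ->
  (forall y, S y ->
    Num.sqrt (B (delay L y) (delay L y)) <= Num.sqrt (B y y)) -> S v ->
  Num.sqrt (B (neumann s L k v 0) (neumann s L k v 0)) <=
  2 * k%:R * Num.sqrt (B v v).
Proof.
move=> hS hB Sd Bd Sv; elim: k => [|k IH].
  have [_ Bl _] := hB.
  by rewrite /= (linear_on0 hS (Bl 0 hS.1)) sqrtr0 mulr0 mul0r.
have Sk : S (neumann s L k v 0) by apply: neumann_sub => //; exact: hS.1.
have Sdk := Sd _ Sk.
rewrite /= (le_trans (psd_form_triangle hS hB _ _))//; [exact: subspaceZ..|].
rewrite !(psd_form_scale _ hS hB)// normrM normr_sign mul1r mulr1 ger0_norm//.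
by have := Bd _ Sk; rewrite -natr1; nra.
Qed.

End DelayOnSplines.

(** * Dyadic sums and the half norm integral *)

Section DyadicSums.
Context {R : realType}.
Notation mu := (@lebesgue_measure R).
Implicit Types (F : R -> R) (A B a d : R).

(** Used with F the square of the K-functional, in which case it is the
    integrand of the interpolation norm. *)
Definition half_integrand F : R -> \bar R := fun t => (t ^- 2 * F t)%:E.

Lemma continuous_expNn2 (t : R) : 0 < t -> {for t, continuous (fun x : R => x ^- 2)}.
Proof.
move=> t0; apply: (@continuous_comp _ _ _ (fun x : R => x ^+ 2) GRing.inv).
  exact: exprn_continuous.
by apply: inv_continuous; rewrite expf_neq0// gt_eqF.
Qed.

Lemma measurable_half_integrand F :
  (forall t, 0 < t -> 0 <= F t) ->
  (forall s t, 0 < s -> s <= t -> F s <= F t) ->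
  measurable_fun (`]0, +oo[%classic : set R) (half_integrand F).
Proof.
move=> F0 Fm; apply/measurable_EFinP; apply: measurable_funM.
  apply: open_continuous_measurable_fun => // t.
  by rewrite inE/= in_itv/= andbT; exact: continuous_expNn2.
apply: (eq_measurable_fun (fun t : R => if (0 < t)%R then F t else 0%R)).
  by move=> t; rewrite inE/= in_itv/= andbT => ->.
apply: nondecreasing_measurable => // s t st.
case: ifPn => [s0|_]; first by rewrite (lt_le_trans s0 st) Fm.
by case: ifPn => // /F0.
Qed.

Lemma half_integrand_ge0 F t : (forall t, 0 < t -> 0 <= F t) -> 0 < t ->
  (0 <= half_integrand F t)%E.
Proof. by move=> F0 t0; rewrite lee_fin mulr_ge0 ?invr_ge0 ?sqr_ge0 ?F0. Qed.

Lemma integral_itv_oc_cst (a b c : R) : a <= b ->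
  (\int[mu]_(t in `]a, b]) c%:E = (c * (b - a))%:E)%E.
Proof.
move=> ab; rewrite integral_cst//= lebesgue_measure_itv/= lte_fin.
case: ltP => [_|ba]; first by rewrite -EFinB -EFinM.
by rewrite (_ : b - a = 0) ?mulr0 ?mule0//; lra.
Qed.

Section Bounds.
Variable F : R -> R.
Hypothesis F0 : forall t : R, 0 < t -> 0 <= F t.
Hypothesis Fm : forall s t : R, 0 < s -> s <= t -> F s <= F t.
Let G := half_integrand F.

Let mG a (y : itv_bound R) : 0 <= a -> measurable_fun [set` Interval (BRight a) y] G.
Proof.
move=> a0; apply: measurable_funS (measurable_half_integrand F0 Fm) => //.
apply: subset_itv => //; rewrite ?bnd_simp//.
Qed.

Let G0 a (y : itv_bound R) t : 0 <= a -> [set` Interval (BRight a) y] t ->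
  (0 <= G t)%E.
Proof.
move=> a0 /= ht; apply: half_integrand_ge0 => //.
by apply: le_lt_trans a0 _; move: ht; case: y => [[] ?|[]]; rewrite in_itv/= ?andbT => // /andP[].
Qed.

Lemma integral_split a b (y : itv_bound R) : 0 <= a -> a <= b ->
  (BRight b <= y)%O ->
  (\int[mu]_(t in [set` Interval (BRight a) y]) G t =
   \int[mu]_(t in `]a, b]) G t + \int[mu]_(t in [set` Interval (BRight b) y]) G t)%E.
Proof.
move=> a0 ab bY.
have E : [set` Interval (BRight a) y] =
    `]a, b]%classic `|` [set` Interval (BRight b) y].
  by apply: itv_bndbnd_setU => //; rewrite bnd_simp.
rewrite E ge0_integral_setU//.
- by rewrite -E; exact: mG.
- by move=> t; rewrite -E; exact: G0.
- apply/disj_setPS => t [/=]; rewrite in_itv/= => /andP[_ tb] ht.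
  suff : b < t by rewrite ltNge tb.
  by move: ht; case: (y) => [[] ?|[]]; rewrite in_itv/= ?andbT => // /andP[].
Qed.

Lemma dyadic_piece_ge a : 0 < a ->
  ((F a / (4 * a))%:E <= \int[mu]_(t in `]a, (2 * a)%R]) G t)%E.
Proof.
move=> a0; have a2 : a <= 2 * a by lra.
apply: (@le_trans _ _ (\int[mu]_(t in `]a, (2 * a)%R]) ((2 * a) ^- 2 * F a)%:E)%E).
  rewrite integral_itv_oc_cst// lee_fin le_eqVlt; apply/orP; left; apply/eqP.
  by field; rewrite gt_eqF.
apply: ge0_le_integral => //.
- by move=> t _; rewrite lee_fin mulr_ge0 ?invr_ge0 ?sqr_ge0 ?F0.
- by apply: mG; exact: ltW.
- move=> t; rewrite /= in_itv/= => /andP[ta t2a]; have t0 := lt_trans a0 ta.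
  rewrite lee_fin ler_pM ?invr_ge0 ?sqr_ge0 ?F0//; last exact/Fm/ltW.
  rewrite lef_pV2 ?posrE ?exprn_gt0//; last lra.
  by rewrite lerXn2r ?nnegrE//; lra.
Qed.

Lemma dyadic_piece_le a : 0 < a ->
  (\int[mu]_(t in `]a, (2 * a)%R]) G t <= (2 * (F (2 * a) / (2 * a)))%:E)%E.
Proof.
move=> a0; have a2 : a <= 2 * a by lra.
apply: (@le_trans _ _ (\int[mu]_(t in `]a, (2 * a)%R]) (a ^- 2 * F (2 * a))%:E)%E); last first.
  rewrite integral_itv_oc_cst// lee_fin le_eqVlt; apply/orP; left; apply/eqP.
  by field; rewrite gt_eqF.
have F2a : 0 <= F (2 * a) by apply: F0; lra.
apply: ge0_le_integral => //.
- by move=> t; exact/G0/ltW.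
- by apply: mG; exact: ltW.
- move=> t; rewrite /= in_itv/= => /andP[ta t2a]; have t0 := lt_trans a0 ta.
  rewrite lee_fin ler_pM ?invr_ge0 ?sqr_ge0 ?F0//; last exact: Fm.
  rewrite lef_pV2 ?posrE ?exprn_gt0//.
  by rewrite lerXn2r ?nnegrE//; lra.
Qed.

Definition dyadic d (i : nat) : R := d * 2 ^+ i.

Lemma dyadic_gt0 d i : 0 < d -> 0 < dyadic d i.
Proof. by move=> d0; rewrite mulr_gt0// exprn_gt0. Qed.

Lemma dyadicS d i : dyadic d i.+1 = 2 * dyadic d i.
Proof. by rewrite /dyadic exprS mulrCA. Qed.

Definition dyadic_sum d m : R :=
  \sum_(i < m) F (dyadic d i.+1) / dyadic d i.+1.

(** Each interval ]t_i, 2 t_i] contributes at least F(t_i) / (4 t_i). *)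
Lemma dyadic_sum_le_integral d m : 0 < d ->
  ((4^-1 * dyadic_sum d m)%:E <= \int[mu]_(t in `]0%R, +oo[) G t)%E.
Proof.
move=> d0.
apply: (@le_trans _ _ (\int[mu]_(t in `]dyadic d 1, dyadic d m.+1]) G t)%E); last first.
  apply: ge0_subset_integral => //.
  - by apply: mG.
  - by move=> t; apply: G0.
  - by apply: subset_itv => //; rewrite bnd_simp ltW// dyadic_gt0.
elim: m => [|m IH].
  by rewrite /dyadic_sum big_ord0 mulr0 set_itvoc0 integral_set0.
have dm := dyadic_gt0 m.+1 d0.
rewrite (@integral_split _ (dyadic d m.+1)); last 3 first.
- exact/ltW/dyadic_gt0.
- rewrite /dyadic ler_pM2l// ler_eXn2l//; last by rewrite ltr1n.
- by rewrite bnd_simp (dyadicS d m.+1); lra.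
rewrite /dyadic_sum big_ord_recr/= mulrDr EFinD leeD//.
rewrite (dyadicS d m.+1) (le_trans _ (dyadic_piece_ge dm))// lee_fin.
by rewrite [X in _ <= _ * X]invfM [X in _ <= X]mulrCA.
Qed.

(** The integral of t^-2 over ]a, oo[ is 1 / a. *)
Lemma tail_le a B : 0 < a -> (forall t, 0 < t -> F t <= B) ->
  (\int[mu]_(t in `]a, +oo[) G t <= (B / a)%:E)%E.
Proof.
move=> a0 FB; have B0 : 0 <= B := le_trans (F0 a0) (FB _ a0).
(* P is a primitive of f that tends to 0 at infinity *)
pose f t := B * t ^- 2; pose P t := - (B * t^-1).
have cf (t : R) : 0 < t -> {for t, continuous f}.
  by move=> t0; apply: cvgM; [exact: cvg_cst|exact: continuous_expNn2].
have dP (t : R) : 0 < t -> is_derive t 1 P (f t).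
  move=> t0.
  have di : is_derive t 1 (fun x : R => x^-1) (- t ^- 2).
    apply: is_derive_eq; first by apply: (@is_deriveV _ id); rewrite /= gt_eqF.
    by rewrite [_ *: _]mulr1.
  have := is_deriveN (is_deriveM (is_derive_cst B t 1) di).
  rewrite (_ : - (cst B * _) = P); last by apply/funext.
  move=> /is_derive_eq; apply; rewrite /f /= /GRing.scale/=; ring.
have cP (t : R) : 0 < t -> {for t, continuous P}.
  move=> t0; apply: differentiable_continuous; apply/derivable1_diffP.
  by have [] := dP t t0.
have <- : (\int[mu]_(t in `[a, +oo[) (f t)%:E = (B / a)%:E)%E.
  rewrite (@ge0_continuous_FTC2y _ f P a 0).
  - by rewrite /P EFinN oppeK add0e.
  - by move=> x _; rewrite mulr_ge0// invr_ge0 sqr_ge0.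
  - apply/continuous_within_itvcyP; split.
      by move=> x; rewrite in_itv/= andbT => ax; apply: cf; exact: lt_trans ax.
    exact/cvg_at_right_filter/cf.
  - rewrite -oppr0; apply: cvgN; rewrite -(mulr0 B); apply: cvgM.
      exact: cvg_cst.
    apply/(gtr0_cvgV0 (f := id)); last exact: cvg_id.
    exact: nbhs_pinfty_gt.
  - by move=> x ax; have [] := dP x (lt_trans a0 ax).
  - exact/cvg_at_right_filter/cP.
  - move=> x; rewrite in_itv/= andbT => ax.
    by rewrite derive1E; have [_ ->] := dP x (lt_trans a0 ax).
rewrite -integral_itv_obnd_cbnd; last first.
  apply/measurable_EFinP.
  apply: open_continuous_measurable_fun => // t.
  by rewrite inE/= in_itv/= andbT => ta; apply: cf; exact: lt_trans ta.
apply: ge0_le_integral => //.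
- by move=> t; exact/G0/ltW.
- by apply: mG; exact: ltW.
- apply/measurable_EFinP.
  apply: open_continuous_measurable_fun => // t.
  by rewrite inE/= in_itv/= andbT => ta; apply: cf; exact: lt_trans ta.
- move=> t; rewrite /= in_itv/= andbT => ta; have t0 := lt_trans a0 ta.
  by rewrite lee_fin mulrC ler_wpM2r ?invr_ge0 ?sqr_ge0 ?FB.
Qed.

Lemma head_le a A : 0 < a -> (forall t, 0 < t -> F t <= A * t ^+ 2) ->
  (\int[mu]_(t in `]0%R, a]) G t <= (A * a)%:E)%E.
Proof.
move=> a0 FA; rewrite -{2}(subr0 a) -(integral_itv_oc_cst A (ltW a0)).
apply: ge0_le_integral => //.
- by move=> t; apply: G0.
- by apply: mG.
- move=> t; rewrite /= in_itv/= => /andP[t0 _].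
  by rewrite lee_fin mulrC ler_pdivrMr ?exprn_gt0// FA.
Qed.

(** Each interval ]t_i, 2 t_i] contributes at most 2 F(2 t_i) / (2 t_i); below
    d and above the last dyadic point the two growth bounds are integrated. *)
Lemma integral_le_dyadic_sum d m A B : 0 < d ->
  (forall t, 0 < t -> F t <= A * t ^+ 2) -> (forall t, 0 < t -> F t <= B) ->
  (\int[mu]_(t in `]0%R, +oo[) G t <=
    (2 * dyadic_sum d m + A * d + B / dyadic d m)%:E)%E.
Proof.
move=> d0 FA FB; have dm := dyadic_gt0 m d0.
rewrite (@integral_split _ (dyadic d m))//; last exact: ltW.
rewrite EFinD leeD//; last exact: tail_le.
elim: m dm => [_|m IH _].
  rewrite /dyadic_sum big_ord0 mulr0 add0r /dyadic expr0 mulr1.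
  exact: head_le.
have dm := dyadic_gt0 m d0.
rewrite (@integral_split _ (dyadic d m)); last 3 first.
- by [].
- exact: ltW.
- by rewrite bnd_simp dyadicS; lra.
have := leeD (IH dm) (dyadic_piece_le dm); rewrite -dyadicS.
move=> /le_trans; apply; rewrite -EFinD lee_fin /dyadic_sum big_ord_recr/=.
by rewrite mulrDr addrAC.
Qed.

End Bounds.

End DyadicSums.

(** * The K-functional of the couple H^1, L2 *)

Section KFunctional.
Context {R : realType} {V : lmodType R}.
Variables (X : V -> Prop) (normX normY : V -> R).
Implicit Types (t c : R) (u v : V).
Notation K := (K_functional_sqr X normX normY).

Lemma K_functional_ge t u c : (exists v, X v) ->
  (forall v, X v -> c <= normY (u - v) ^+ 2 + t ^+ 2 * normX v ^+ 2) ->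
  c <= K t u.
Proof.
by move=> [v0 Xv0] h; apply: lb_le_inf; [eexists; exists v0|move=> _ [v Xv <-]; exact: h].
Qed.

Lemma K_functional_le t u v : X v ->
  K t u <= normY (u - v) ^+ 2 + t ^+ 2 * normX v ^+ 2.
Proof.
move=> Xv; apply: ge_inf; last by exists v.
by exists 0 => _ [w Xw <-]; rewrite addr_ge0 ?sqr_ge0// mulr_ge0 ?sqr_ge0.
Qed.

Lemma K_functional_ge0 t u : (exists v, X v) -> 0 <= K t u.
Proof.
by move=> X0; apply: K_functional_ge => // v _; rewrite addr_ge0 ?sqr_ge0// mulr_ge0 ?sqr_ge0.
Qed.

Lemma K_functional_homo s t u : (exists v, X v) -> 0 < s -> s <= t ->
  K s u <= K t u.
Proof.
move=> X0 s0 st; apply: K_functional_ge => // v Xv.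
rewrite (le_trans (K_functional_le s u Xv))// lerD2l ler_wpM2r ?sqr_ge0//.
by rewrite lerXn2r ?nnegrE ?(ltW s0)// (le_trans (ltW s0)).
Qed.

End KFunctional.

Section HalfNorm.
Context {R : realType}.
Notation mu := (@lebesgue_measure R).
Implicit Types (T t : R) (M : bool -> seq R) (u v w y z : bool -> R -> R).

Definition K2 T t u := K_functional_sqr (H10S T) (H10S_norm T) (L2S_norm T) t u.

Lemma H10S_ex T : 0 < T -> exists v, H10S T v.
Proof. by move=> T0; exists 0; exact: (H10S_subspace T0).1. Qed.

Lemma K2_ge0 T t u : 0 < T -> 0 <= K2 T t u.
Proof. by move=> T0; apply: K_functional_ge0; exact: H10S_ex. Qed.

Lemma K2_homo T s t u : 0 < T -> 0 < s -> s <= t -> K2 T s u <= K2 T t u.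
Proof. by move=> T0; apply: K_functional_homo; exact: H10S_ex. Qed.

Lemma L2S_norm0 T : L2S_norm T 0 = 0.
Proof.
have hL := L2S_subspace T; have [_ Bl _] := L2S_form T.
by rewrite /L2S_norm (linear_on0 hL (Bl _ hL.1)) sqrtr0.
Qed.

Lemma K2_le_L2 T t u : 0 < T -> K2 T t u <= L2S_norm T u ^+ 2.
Proof.
move=> T0; have hH := H10S_subspace T0; have [_ Bl _] := H10S_form T0.
have := K_functional_le (H10S_norm T) (L2S_norm T) t u hH.1.
rewrite subr0 [X in _ + _ * X](H10S_norm_sqr T 0) (linear_on0 hH (Bl _ hH.1)).
by rewrite mulr0 addr0.
Qed.

Lemma K2_le_H1 T t u : H10S T u -> K2 T t u <= H10S_norm T u ^+ 2 * t ^+ 2.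
Proof.
move=> Hu; have := K_functional_le (H10S_norm T) (L2S_norm T) t u Hu.
by rewrite subrr L2S_norm0 expr0n/= add0r mulrC.
Qed.

Definition K2_integral T u : \bar R :=
  (\int[mu]_(t in `]0%R, +oo[) half_integrand (fun t => K2 T t u) t)%E.

Lemma K2_integral_ge0 T u : 0 < T -> (0 <= K2_integral T u)%E.
Proof.
move=> T0; apply: integral_ge0 => t; rewrite /= in_itv/= andbT => t0.
by apply: half_integrand_ge0 => // s _; exact: K2_ge0.
Qed.

Lemma K2_integral_le T u d m : 0 < T -> 0 < d -> H10S T u ->
  (K2_integral T u <= (2 * dyadic_sum (fun t => K2 T t u) d m +
    H10S_norm T u ^+ 2 * d + L2S_norm T u ^+ 2 / dyadic d m)%:E)%E.
Proof.
move=> T0 d0 Hu; apply: integral_le_dyadic_sum => // [t _|s t s0 st|t _|t _].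
- exact: K2_ge0.
- exact: K2_homo.
- exact: K2_le_H1.
- exact: K2_le_L2.
Qed.

Lemma dyadic_sum_K2_le T u d m : 0 < T -> 0 < d ->
  ((4^-1 * dyadic_sum (fun t => K2 T t u) d m)%:E <= K2_integral T u)%E.
Proof.
move=> T0 d0; apply: dyadic_sum_le_integral => // [t _|s t s0 st].
- exact: K2_ge0.
- exact: K2_homo.
Qed.

Let two_pi_gt0 : 0 < 2 / pi :> R.
Proof. by rewrite divr_gt0// pi_gt0. Qed.

Lemma K2_integral_fin T u : 0 < T -> H12S T u -> K2_integral T u \is a fin_num.
Proof.
move=> T0 [_ hu]; have I0 := K2_integral_ge0 u T0.
rewrite ge0_fin_numE// ltey; apply: contraTneq hu => /= Iy.
rewrite /interp_half_sqr -/(K2_integral T u) Iy.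
by rewrite gt0_muley ?ltxx// lte_fin.
Qed.

Lemma H12S_norm_sqr T u : 0 < T -> H12S T u ->
  H12S_norm T u ^+ 2 = 2 / pi * fine (K2_integral T u).
Proof.
move=> T0 hu; have Ifin := K2_integral_fin T0 hu.
have I0 := K2_integral_ge0 u T0.
rewrite /H12S_norm /interp_half_norm /interp_half_sqr -/(K2_integral T u).
rewrite fineM// sqr_sqrtr//=.
by rewrite mulr_ge0 ?(ltW two_pi_gt0)// fine_ge0.
Qed.

(** Finiteness of the interpolation norm: the squared K-functional is at most
    min(|u|^2, t^2 |u|_1^2). *)
Lemma H10S_H12S T u : 0 < T -> H10S T u -> H12S T u.
Proof.
move=> T0 Hu; split; first exact: H10S_L2S.
rewrite /interp_half_sqr -/(K2_integral T u).
have Ifin : (K2_integral T u < +oo)%E.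
  by apply: le_lt_trans (K2_integral_le 0 T0 ltr01 Hu) _; rewrite ltry.
by rewrite lte_mul_pinfty// lee_fin ltW.
Qed.

Lemma dyadic_sum_H12S T u d m : 0 < T -> 0 < d -> H12S T u ->
  dyadic_sum (fun t => K2 T t u) d m <= 2 * pi * H12S_norm T u ^+ 2.
Proof.
move=> T0 d0 hu; rewrite H12S_norm_sqr//.
have := dyadic_sum_K2_le u m T0 d0.
rewrite -(fineK (K2_integral_fin T0 hu)) lee_fin => h.
rewrite [leRHS](_ : _ = 4 * fine (K2_integral T u)); first by lra.
by move: (lt0r_neq0 (pi_gt0 R)); move: (pi : R) => p p0; field.
Qed.

End HalfNorm.

(** * Galerkin approximation of the K-functional *)

Section AbstractGalerkin.
Context {R : realType} {V : lmodType R}.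
Variables (S X Y : V -> Prop) (a b : V -> V -> R) (normX normY : V -> R).
Hypotheses (hS : subspace S) (hX : subspace X) (hY : subspace Y).
Hypotheses (SX : forall v, S v -> X v) (XY : forall v, X v -> Y v).
Hypotheses (ha : psd_form Y a) (hb : psd_form X b).
Hypotheses (normXE : forall v, normX v ^+ 2 = b v v)
           (normYE : forall v, normY v ^+ 2 = a v v).
Implicit Types (t C : R) (u v w y z : V).

(** The Euler-Lagrange equation of the minimisation of |u - v|^2 + t^2 |v|_1^2
    over S. *)
Definition galerkin t u v :=
  S v /\ forall z, S z -> a (u - v) z = t ^+ 2 * b v z.

(** For a solution v of the Galerkin equation, the minimum, that is, the
    squared K-functional of u with competitors in S only. *)
Definition galerkin_energy t u v := a (u - v) (u - v) + t ^+ 2 * b v v.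

Let SY v : S v -> Y v. Proof. by move=> /SX; exact: XY. Qed.

Lemma galerkin_energy_ge0 t u v : Y u -> S v -> 0 <= galerkin_energy t u v.
Proof.
move=> Yu Sv; have [_ _ ap] := ha; have [_ _ bp] := hb.
apply: addr_ge0; first exact: ap (subspaceB hY Yu (SY Sv)).
exact: mulr_ge0 (sqr_ge0 t) (bp _ (SX Sv)).
Qed.

Lemma galerkin_ip_self t u v : Y u -> galerkin t u v ->
  a (u - v) u = galerkin_energy t u v.
Proof.
move=> Yu [Sv vE]; have Yv := SY Sv; have Yuv := subspaceB hY Yu Yv.
rewrite -{2}(subrK v u) (linear_onD (psd_formr ha hY Yuv) Yuv Yv).
by rewrite (vE v Sv).
Qed.

(** Testing against the projection q of z instead of z itself changes nothing
    because u - v lies in S; the stability of the projection then bounds the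
    energy of q by that of z. *)
Lemma galerkin_ip_le C t u v y : 0 <= C ->
  (forall z, X z -> exists q, [/\ S q, forall x, S x -> a (z - q) x = 0 &
    b q q <= C * b z z]) ->
  S u -> galerkin t u v -> Y y ->
  a (u - v) y ^+ 2 <=
  (1 + C) * galerkin_energy t u v * K_functional_sqr X normX normY t y.
Proof.
move=> C0 stable Su [Sv vE] Yy.
have [asym al ap] := ha; have [_ bl bp] := hb.
have Suv : S (u - v) := subspaceB hS Su Sv.
have Yuv := SY Suv; have Xv := SX Sv.
have t20 := sqr_ge0 t.
have key z : X z -> a (u - v) y ^+ 2 <= (1 + C) * galerkin_energy t u v *
    (normY (y - z) ^+ 2 + t ^+ 2 * normX z ^+ 2).
  move=> Xz; have Yz := XY Xz; have [q [Sq qE hq]] := stable z Xz.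
  have Xq := SX Sq; have Yq := XY Xq.
  have Yyz : Y (y - z) := subspaceB hY Yy Yz.
  (* u - v is orthogonal to z - q, hence <u - v, z> = <u - v, q> = t^2 b v q *)
  have -> : a (u - v) y = a (u - v) (y - z) + t ^+ 2 * b v q.
    rewrite -(vE q Sq) (linear_onB hY (psd_formr ha hY Yuv) Yy Yz).
    have := qE _ Suv; rewrite (linear_onB hY (al _ Yuv) Yz Yq).
    rewrite (asym z _ Yz Yuv) (asym q _ Yq Yuv) => /eqP.
    by rewrite subr_eq0 => /eqP ->; rewrite subrK.
  have h1 := psd_form_CS hY ha Yuv Yyz.
  have h2 := sqr_scale_le (t ^+ 2) (psd_form_CS hX hb Xv Xq).
  have := sqr_add_le (ap _ Yuv) (ap _ Yyz) (mulr_ge0 t20 (bp _ Xv))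
                     (mulr_ge0 t20 (bp _ Xq)) h1 h2.
  move=> /le_trans; apply; rewrite /galerkin_energy normXE normYE.
  by apply: mul_add_le => //; [exact: ap|exact: ap|exact: bp|exact: bp].
have E0 : 0 <= (1 + C) * galerkin_energy t u v.
  exact: mulr_ge0 (addr_ge0 ler01 C0) (galerkin_energy_ge0 t (SY Su) Sv).
move: E0; rewrite le_eqVlt => /predU1P[E0|E0].
  by have := key 0 hX.1; rewrite -E0 !mul0r.
rewrite mulrC -ler_pdivrMr//; apply: K_functional_ge; first by exists 0; exact: hX.1.
by move=> z Xz; rewrite ler_pdivrMr// mulrC; exact: key.
Qed.

End AbstractGalerkin.

Section GalerkinOnSplines.
Context {R : realType}.
Implicit Types (T t L : R) (M : bool -> seq R) (u v w y z : bool -> R -> R).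

Definition galerkinS T M := galerkin (S1 T M) (L2S_ip T) (H10S_ip T).
Definition energyS T := galerkin_energy (L2S_ip T) (H10S_ip T).

Lemma H10S_ip_zero T M z : 0 < T -> is_mesh T M -> S1 T M z ->
  (forall b, {in `[0, T], z b =1 cst 0}) -> H10S_ip T z z = 0.
Proof.
move=> T0 hM Sz z0.
rewrite -H10S_norm_sqr (S1_H10S_norm T0 hM Sz) L2S_norm_sqr.
apply: big1 => b _; apply: Rintegral_eq0 => s s0T.
rewrite derive1E (@near_eq_derive _ _ _ _ (cst 0)) ?derive_cst ?mulr0//.
move: s0T; rewrite /= in_itv/= => /andP[s0 sT].
near=> r; apply: z0; rewrite in_itv/=; apply/andP; split.
- by apply: ltW; near: r; exact: lt_nbhsr.
- by apply: ltW; near: r; exact: lt_nbhsl.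
Unshelve. all: by end_near. Qed.

Lemma galerkinS_exists T M t u : 0 < T -> is_mesh T M -> L2S T u ->
  exists v, galerkinS T M t u v.
Proof.
move=> T0 hM Lu.
have SL v : S1 T M v -> L2S T v by exact: S1_L2S.
have SH v : S1 T M v -> H10S T v by exact: S1_H10S.
have hL := L2S_subspace T; have hB := L2S_form T; have [_ Bl Bp] := hB.
have hD := H10S_form T0; have [_ _ Dp] := hD.
have hB' := psd_formD (psd_form_sub SL hB) (psd_form_sub SH hD) (sqr_ge0 t).
have [|||v Sv vE] := @S1_riesz R T M _ (L2S_ip T u) hM hB'.
- by move=> z Sz z0; rewrite L2S_ip_zero// (H10S_ip_zero T0 hM Sz z0) mulr0 addr0.
- exact: linear_on_sub SL (psd_formr hB hL Lu).
- move=> z Sz B0; apply: (psd_form_null hL hB Lu (SL _ Sz)).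
  apply/eqP; rewrite eq_le (Bp _ (SL _ Sz)) andbT -B0 lerDl.
  exact: mulr_ge0 (sqr_ge0 t) (Dp _ (SH _ Sz)).
exists v; split => // z Sz.
rewrite (linear_onB hL (Bl _ (SL _ Sz)) Lu (SL _ Sv)).
by rewrite -(vE z Sz) addrC addKr.
Qed.

Lemma Q0_stable T M cs z : 0 < T -> is_mesh T M -> H1_stable T M cs ->
  H10S T z -> exists q, [/\ S1 T M q,
    forall x, S1 T M x -> L2S_ip T (z - q) x = 0 &
    H10S_ip T q q <= cs ^+ 2 * H10S_ip T z z].
Proof.
move=> T0 hM hcs Hz; have [SQ QE] := Q0P T0 hM (H10S_L2S T0 Hz).
exists (Q0 T M z); split=> //; rewrite -2!H10S_norm_sqr -exprMn.
have := hcs _ Hz; have := H10S_norm_ge0 T (Q0 T M z).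
move: (H10S_norm T (Q0 T M z)) (cs * H10S_norm T z) => p r p0 pr.
by rewrite lerXn2r ?nnegrE// (le_trans p0).
Qed.

Lemma half_id_double_layer_S1 L n M s w : 0 < L -> (0 < n)%N ->
  is_mesh (n%:R * L) M -> slice_matching L n M -> S1 (n%:R * L) M w ->
  S1 (n%:R * L) M (half_id_double_layer s L w).
Proof.
move=> L0 n0 hM hmatch Sw; have hS := S1_subspace (n%:R * L) M.
rewrite (_ : half_id_double_layer _ _ _ =
    ((-1) ^+ s * 2^-1) *: w + (- 2^-1) *: delay L w); last first.
  by apply/funext => b; apply/funext => r.
exact: hS.2 _ _ _ Sw (subspaceZ _ hS (delay_S1 L0 n0 hM hmatch Sw)).
Qed.

(** The competitor for w is the Neumann sum z of v.  Since w is the Neumann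
    iterate of A w started at w, the difference w - z is an iterate of A w -
    v, which agrees on (0, T) with the one started at 0. *)
Lemma K2_le_energy L n M s t w v : 0 < L -> (0 < n)%N ->
  is_mesh (n%:R * L) M -> slice_matching L n M ->
  S1 (n%:R * L) M w ->
  galerkinS (n%:R * L) M t (half_id_double_layer s L w) v ->
  K2 (n%:R * L) t w <=
  4 * n%:R ^+ 2 * energyS (n%:R * L) t (half_id_double_layer s L w) v.
Proof.
move=> L0 n0 hM hmatch Sw [Sv _].
have Su := half_id_double_layer_S1 s L0 n0 hM hmatch Sw.
have T0 : 0 < n%:R * L by rewrite mulr_gt0// ltr0n.
have Sd y : S1 (n%:R * L) M y -> S1 (n%:R * L) M (delay L y) by exact: delay_S1.
have [T TE] : exists T, n%:R * L = T by eexists.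
rewrite TE in hM Sw Sv Su T0 Sd *; have := neumann_fixed s L n w.
move: (half_id_double_layer s L w) Su => u Su nE.
have hS := S1_subspace T M.
have SL x : S1 T M x -> L2S T x by exact: S1_L2S.
have SH x : S1 T M x -> H10S T x by exact: S1_H10S.
have Suv := subspaceB hS Su Sv.
pose z := neumann s L n v 0.
have Sz : S1 T M z by exact: (neumann_sub s n hS Sd Sv hS.1).
have hz1 : L2S_norm T (w - z) <= 2 * n%:R * L2S_norm T (u - v).
  have -> : L2S_norm T (w - z) = L2S_norm T (neumann s L n (u - v) 0).
    rewrite -{1}nE -neumannB subr0 2!L2S_normE; congr Num.sqrt.
    apply: eq_L2S_ip => b r; rewrite inE/= in_itv/= => /andP[r0 rT];
      by apply: neumann_start; rewrite r0 TE ltW.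
  rewrite 2!L2S_normE.
  apply: (neumann_norm_le s n hS (psd_form_sub SL (L2S_form T)) Sd) => // y Sy.
  by rewrite -2!L2S_normE; exact: (delay_L2S_norm_le T0 L0 hM Sy (Sd _ Sy)).
have hz2 : H10S_norm T z <= 2 * n%:R * H10S_norm T v.
  have Dd y : S1 T M y ->
      Num.sqrt (H10S_ip T (delay L y) (delay L y)) <= Num.sqrt (H10S_ip T y y).
    move=> Sy; have := delay_H10S_norm_le T0 L0 hM Sy (Sd _ Sy).
    by rewrite 2!H10S_normE.
  rewrite (H10S_normE T z) (H10S_normE T v).
  exact: (neumann_norm_le s n hS (psd_form_sub SH (H10S_form T0)) Sd Dd Sv).
have := K_functional_le (H10S_norm T) (L2S_norm T) t w (SH _ Sz).
move=> /le_trans; apply.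
have := L2S_norm_ge0 T (w - z); have := H10S_norm_ge0 T z.
have := L2S_norm_sqr T (u - v); have := H10S_norm_sqr T v.
rewrite /energyS /galerkin_energy => <- <-.
move: hz1 hz2; move: (L2S_norm T (w - z)) (L2S_norm T (u - v)) => p q.
move: (H10S_norm T z) (H10S_norm T v) => p' q' h1 h2 p'0 p0.
have sq (c x x' : R) : 0 <= x -> x <= c * x' -> x ^+ 2 <= c ^+ 2 * x' ^+ 2.
  by move=> x0 xc; rewrite -exprMn lerXn2r ?nnegrE// (le_trans x0).
have e : (2 * n%:R) ^+ 2 = 4 * n%:R ^+ 2 :> R by rewrite exprMn; congr (_ * _); ring.
rewrite -e mulrDr; apply: lerD; first exact: sq.
by rewrite [leRHS]mulrCA; apply: ler_wpM2l; [exact: sqr_ge0|exact: sq].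
Qed.

End GalerkinOnSplines.

(** * The dual norm and the test function *)

Section DualNorm.
Context {R : realType}.
Implicit Types (T E : R) (u w y : bool -> R -> R).

Lemma H12S_norm_ge0 T u : 0 <= H12S_norm T u.
Proof. exact: sqrtr_ge0. Qed.

Lemma H12S_dual_norm_ge0 T u : 0 <= H12S_dual_norm T u.
Proof.
rewrite /H12S_dual_norm; set S := image _ _.
have [[y Sy]|/set0P/negP/negPn/eqP ->] := pselect (S !=set0); last first.
  by rewrite ereal_sup0.
apply: fine_ge0; apply: le_trans (ereal_sup_ubound Sy).
by case: Sy => v _ <-; rewrite lee_fin divr_ge0 ?H12S_norm_ge0.
Qed.

(** The dual norm is a supremum in the extended reals, cut down to a real
    number by [fine]; the bound on the pairing and the element u guarantee
    that it is finite and is taken over a nonempty set. *)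
Lemma H12S_dual_norm_bounds T E w u : 0 <= E ->
  (forall y, H12S T y -> `|L2S_ip T w y| <= E * H12S_norm T y) ->
  H12S T u -> L2S_norm T u != 0 ->
  H12S_dual_norm T w <= E /\
  `|L2S_ip T w u| <= H12S_dual_norm T w * H12S_norm T u.
Proof.
move=> E0 wE hu u0; rewrite /H12S_dual_norm; set S := image _ _.
have Su : S (`|L2S_ip T w u| / H12S_norm T u)%:E by exists u.
have ubS : (ereal_sup S <= E%:E)%E.
  apply: ge_ereal_sup => _ [y [hy _] <-]; rewrite lee_fin.
  have := H12S_norm_ge0 T y; rewrite le_eqVlt => /predU1P[<-|y0].
    by rewrite invr0 mulr0.
  by rewrite ler_pdivrMr// wE.
have lbS := ereal_sup_ubound Su.
have fS : ereal_sup S \is a fin_num.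
  rewrite fin_numE; apply/andP; split.
    by apply: contraTneq lbS => ->.
  by apply: contraTneq ubS => ->.
rewrite -(fineK fS) in ubS lbS; rewrite lee_fin in ubS; rewrite lee_fin in lbS.
split=> //; have := H12S_norm_ge0 T u; rewrite le_eqVlt => /predU1P[u1|u1].
  by have := wE _ hu; rewrite -u1 !mulr0.
by rewrite -ler_pdivrMr.
Qed.

End DualNorm.

Section InfSup.
Context {R : realType}.
Implicit Types (T t L d : R) (M : bool -> seq R) (u v w y z : bool -> R -> R).

(** Every spline space contains this function, so the supremum in the theorem
    is taken over a nonempty set. *)
Lemma ramp_S1 T M : S1 T M (fun _ t => t).
Proof.
move=> b; split=> // [x|e _]; first by apply: continuous_subspaceT => t; exact: cvg_id.
by exists 0, 1 => t _; rewrite add0r mul1r.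
Qed.

Lemma ramp_norm_neq0 T : 0 < T -> L2S_norm T (fun _ t => t) != 0.
Proof.
move=> T0.
have E : \int[@lebesgue_measure R]_(t in `]0, T[) (t * t) = T ^+ 3 / 3.
  have cM : continuous (fun t : R => t * t).
    by move=> t; apply: cvgM; exact: cvg_id.
  have iM : lebesgue_measure.-integrable `[0, T] (EFin \o (fun t : R => t * t)).
    apply: continuous_compact_integrable; first exact: segment_compact.
    exact: continuous_subspaceT.
  rewrite Rintegral_itv_bndo_bndc; last first.
    by apply: integrableS iM => //; apply: subset_itv; rewrite bnd_simp.
  rewrite Rintegral_itv_obnd_cbnd; last first.
    by apply: integrableS iM => //; apply: subset_itv; rewrite bnd_simp.
  pose F : R -> R := 3^-1 *: ((id : R -> R) ^+ 3).
  have dF (t : R) : is_derive t 1 F (t * t).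
    by apply: is_derive_eq; rewrite /GRing.scale/=; field.
  have cF : continuous F.
    move=> t; apply: differentiable_continuous; apply/derivable1_diffP.
    by have [] := dF t.
  have FE t : F t = 3^-1 * t ^+ 3.
    by rewrite /F -[LHS]/(3^-1 * ((id : R -> R) ^+ 3) t); congr (_ * _).
  rewrite /Rintegral (@continuous_FTC2 _ (fun t => t * t) F)//.
  - by rewrite -EFinB /= !FE expr0n/= mulr0 subr0 mulrC.
  - exact: continuous_subspaceT.
  - split=> [t _| |]; first by have [] := dF t.
      by apply: cvg_at_right_filter; exact: cF.
    by apply: cvg_at_left_filter; exact: cF.
  - by move=> t _; rewrite derive1E; have [_ ->] := dF t.
rewrite L2S_normE /L2S_ip big_bool /= E lt0r_neq0// sqrtr_gt0.
by rewrite addr_gt0// divr_gt0// exprn_gt0.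
Qed.

Lemma dyadic_tail_small (A B e : R) : 0 <= A -> 0 <= B -> 0 < e ->
  exists2 d, 0 < d & exists m, A * d + B / dyadic d m <= e.
Proof.
(* d makes the first term at most e / 2, and 2^m >= m does so for the second *)
move=> A0 B0 e0; pose d := e / (2 * (A + 1)).
have A1 : 0 < 2 * (A + 1) by rewrite mulr_gt0// ltr_wpDl.
have d0 : 0 < d by rewrite divr_gt0.
exists d => //; pose x := 2 * B / (d * e).
have x0 : 0 <= x.
  by apply: divr_ge0; [exact: mulr_ge0|exact/ltW/mulr_gt0].
have [m xm] : exists m : nat, x <= m%:R.
  by exists (Num.truncn x).+1; exact/ltW/truncnS_gt.
exists m.
have m2 : (m%:R : R) <= 2 ^+ m by rewrite -natrX ler_nat ltnW// ltn_expl.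
have dm := dyadic_gt0 m d0.
have h1 : A * d <= e / 2.
  rewrite /d mulrA ler_pdivrMr// -subr_ge0.
  rewrite (_ : _ - _ = e); first exact: ltW.
  by field.
have h2 : B / dyadic d m <= e / 2.
  rewrite ler_pdivrMr// /dyadic.
  have := le_trans xm m2; rewrite /x (ler_pdivrMr _ _ (mulr_gt0 d0 e0)).
  rewrite (_ : e / 2 * (d * 2 ^+ m) = 2 ^+ m * (d * e) / 2); last by ring.
  by move: (2 ^+ m * (d * e)) => q; lra.
by move: (A * d) (B / _) h1 h2 => p q; lra.
Qed.

(** The element y is a Riemann sum of the integral over t of t^-2 (u - v_t).
    The tails cut off from the integral for w are at most half of it, whence
    the factor 32. *)
Lemma dual_test_function L n M cs s w : 0 < L -> (0 < n)%N ->
  is_mesh (n%:R * L) M -> slice_matching L n M -> H1_stable (n%:R * L) M cs ->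
  S1 (n%:R * L) M w -> 0 < H12S_norm (n%:R * L) w ->
  exists2 y, S1 (n%:R * L) M y & exists N : R,
    [/\ L2S_ip (n%:R * L) y (half_id_double_layer s L w) = N,
      H12S_norm (n%:R * L) w ^+ 2 <= 32 * n%:R ^+ 2 / pi * N &
      forall z, H12S (n%:R * L) z ->
      L2S_ip (n%:R * L) y z ^+ 2 <=
        2 * pi * (1 + cs ^+ 2) * N * H12S_norm (n%:R * L) z ^+ 2].
Proof.
move=> L0 n0 hM hmatch hcs Sw w0.
have Su := half_id_double_layer_S1 s L0 n0 hM hmatch Sw.
have T0 : 0 < n%:R * L by rewrite mulr_gt0// ltr0n.
have K2w t v := @K2_le_energy R L n M s t w v L0 n0 hM hmatch Sw.
have [T TE] : exists T, n%:R * L = T by eexists.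
rewrite TE in hM hcs Sw w0 Su T0 K2w *.
move: (half_id_double_layer s L w) Su K2w => u Su K2w.
have hL := L2S_subspace T; have hB := L2S_form T; have [_ Bl _] := hB.
have hH := H10S_subspace T0; have hD := H10S_form T0; have hS := S1_subspace T M.
have SH x : S1 T M x -> H10S T x by exact: S1_H10S.
have HL x : H10S T x -> L2S T x by exact: H10S_L2S.
have Hw := H10S_H12S T0 (SH _ Sw).
have pi0 := pi_gt0 R.
pose J := fine (K2_integral T w).
have wJ : H12S_norm T w ^+ 2 = 2 / pi * J := H12S_norm_sqr T0 Hw.
have J0 : 0 < J.
  by have := exprn_gt0 2 w0; rewrite wJ pmulr_rgt0// divr_gt0.
(* the tails of the integral J of t^-2 k(t, w)^2 amount to at most J / 2 *)
have [d d0 [m small]] := dyadic_tail_small (sqr_ge0 (H10S_norm T w))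
  (sqr_ge0 (L2S_norm T w)) (divr_gt0 J0 (ltr0Sn _ 1)).
pose t i := dyadic d i.+1.
have t0 i : 0 < t i by exact: dyadic_gt0.
have [vs hvs] := @choice _ _ (fun i v => galerkinS T M (t i) u v)
  (fun i => galerkinS_exists (t i) T0 hM (HL _ (SH _ Su))).
pose e i := energyS T (t i) u (vs i).
have e0 i : 0 <= e i.
  by apply: (galerkin_energy_ge0 hL SH HL hB hD); [exact/HL/SH|exact: (hvs i).1].
pose N := \sum_(i < m) e i / t i.
have JN : J <= 16 * n%:R ^+ 2 * N.
  have := K2_integral_le m T0 d0 (SH _ Sw).
  rewrite -(fineK (K2_integral_fin T0 Hw)) lee_fin -/J.
  have : dyadic_sum (fun t => K2 T t w) d m <= 4 * n%:R ^+ 2 * N.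
    rewrite /dyadic_sum /N mulr_sumr; apply: ler_sum => i _.
    rewrite mulrA ler_wpM2r ?invr_ge0 ?(ltW (t0 i))//.
    exact: (K2w _ _ (hvs i)).
  move: small; rewrite -/(t _).
  move: (dyadic_sum _ _ _) (H10S_norm T w ^+ 2 * d) (L2S_norm T w ^+ 2 / _).
  move=> a b c; lra.
have Suv i : S1 T M (u - vs i) by exact: (subspaceB hS Su (hvs i).1).
pose y := \sum_(i < m) (t i)^-1 *: (u - vs i).
have yE z : L2S T z -> L2S_ip T y z = \sum_(i < m) (t i)^-1 * L2S_ip T (u - vs i) z.
  move=> Lz; apply: (linear_on_sum _ hL (Bl z Lz)) => i; exact/HL/SH.
exists y; first exact: subspace_sum.
exists N; split.
- rewrite yE; last exact/HL/SH.
  apply: eq_bigr => i _; rewrite mulrC; congr (_ / _).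
  apply: (galerkin_ip_self hL SH HL hB _ (hvs i)); exact/HL/SH.
- rewrite wJ; have : 0 <= 2 / pi :> R by rewrite divr_ge0// ltW.
  move=> /ler_wpM2l /(_ _ _ JN) /le_trans; apply.
  by rewrite le_eqVlt; apply/orP; left; apply/eqP; move: (pi : R)^-1 => p; ring.
move=> z Hz; have Lz := Hz.1; rewrite yE//.
have c0 : 0 <= 1 + cs ^+ 2 by rewrite addr_ge0 ?sqr_ge0.
have step i : ((t i)^-1 * L2S_ip T (u - vs i) z) ^+ 2 <=
    ((t i)^-1 * ((1 + cs ^+ 2) * e i)) * ((t i)^-1 * K2 T (t i) z).
  apply: sqr_scale_le.
  apply: (galerkin_ip_le hS hH hL SH HL hB hD _ _ (sqr_ge0 cs) _ Su (hvs i) Lz).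
  - exact: H10S_norm_sqr.
  - exact: L2S_norm_sqr.
  - by move=> x Hx; exact: Q0_stable.
have ti i : 0 <= (t i)^-1 by rewrite invr_ge0 ltW.
have := @sqr_sum_le _ m _ _ _ (fun i => mulr_ge0 (ti i) (mulr_ge0 c0 (e0 i)))
  (fun i => mulr_ge0 (ti i) (K2_ge0 (t i) z T0)) step.
move=> /le_trans; apply.
have -> : \sum_(i < m) (t i)^-1 * ((1 + cs ^+ 2) * e i) = (1 + cs ^+ 2) * N.
  by rewrite /N mulr_sumr; apply: eq_bigr => i _; rewrite mulrC mulrA.
have N0 : 0 <= (1 + cs ^+ 2) * N.
  by rewrite mulr_ge0//; apply: sumr_ge0 => i _; rewrite divr_ge0 ?e0 ?(ltW (t0 i)).
have -> : \sum_(i < m) (t i)^-1 * K2 T (t i) z = dyadic_sum (fun t => K2 T t z) d m.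
  by apply: eq_bigr => i _; rewrite mulrC.
have := ler_wpM2l N0 (dyadic_sum_H12S m T0 d0 Hz).
move=> /le_trans; apply; rewrite le_eqVlt; apply/orP; left; apply/eqP.
by move: (pi : R) => p; ring.
Qed.

End InfSup.

(** * The inf-sup inequality *)

(** Write C = 1 + cs^2, and take y and N from [dual_test_function].  The dual
    norm of y is at most (2 pi C N)^(1/2), so the quotient for y is at least
    (N / (2 pi C))^(1/2), and N >= pi |w|_(1/2)^2 / (32 n^2) turns this into
    |w|_(1/2) / (8 n C^(1/2)). *)
Theorem theorem4p4 (R : realType) (L T : R) (n : nat)
    (hL : 0 < L) (hn : (0 < n)%N) (hT : T = n%:R * L)
    (I : Type) (Sigma : I -> bool -> seq R) (cs : R)
    (hmesh : forall h, is_mesh T (Sigma h))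
    (hstable : forall h, H1_stable T (Sigma h) cs)
    (hmatch : forall h, slice_matching L n (Sigma h)) :
  forall s : bool, exists c : R, 0 < c /\
    forall (h : I) (w : bool -> R -> R), S1 T (Sigma h) w ->
      ((c * H12S_norm T w)%:E <=
       ereal_sup [set (`|L2S_ip T (half_id_double_layer s L w) mu|
                       / H12S_dual_norm T mu)%:E
                 | mu in [set mu | S1 T (Sigma h) mu
                                   /\ (L2S_norm T mu != 0)%R]])%E.
Proof.
move=> s; pose C := 1 + cs ^+ 2.
have C0 : 0 < C by rewrite ltr_wpDr ?sqr_ge0.
have n0 : 0 < n%:R :> R by rewrite ltr0n.
have T0 : 0 < T by rewrite hT mulr_gt0.
have pi0 := pi_gt0 R.
pose k := 8 * n%:R * Num.sqrt C.
have k0 : 0 < k by rewrite !mulr_gt0// sqrtr_gt0.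
exists k^-1; split; first by rewrite invr_gt0.
move=> h w Sw; have hM := hmesh h; have hcs := hstable h.
have := H12S_norm_ge0 T w; rewrite le_eqVlt => /predU1P[<-|w0].
  rewrite mulr0; apply: (@le_trans _ _
    (`|L2S_ip T (half_id_double_layer s L w) (fun _ t => t)|
     / H12S_dual_norm T (fun _ t => t))%:E).
    by rewrite lee_fin divr_ge0// H12S_dual_norm_ge0.
  apply: ereal_sup_ubound; exists (fun _ t => t) => //.
  by split; [exact: ramp_S1|exact: ramp_norm_neq0].
have hM' := hM; have hcs' := hcs; have Sw' := Sw; have w0' := w0.
rewrite hT in hM' hcs' Sw' w0'.
have Su := half_id_double_layer_S1 s hL hn hM' (hmatch h) Sw'.
have [y Sy [N [yN wN yz]]] :=
  dual_test_function s hL hn hM' (hmatch h) hcs' Sw' w0'.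
rewrite -hT in Su Sy yN wN yz.
move: (half_id_double_layer s L w) Su yN => u Su yN.
have hB := L2S_form T; have hLS := L2S_subspace T; have [Bs _ _] := hB.
have Hu : H12S T u by apply: H10S_H12S => //; exact: S1_H10S Su.
have Hy : H12S T y by apply: H10S_H12S => //; exact: S1_H10S Sy.
have N0 : 0 < N.
  have := exprn_gt0 2 w0; move=> /lt_le_trans /(_ wN).
  by rewrite pmulr_rgt0// divr_gt0// mulr_gt0// exprn_gt0.
have u_neq0 : L2S_norm T u != 0.
  apply: contraTneq N0 => u0; rewrite -yN -leNgt.
  rewrite (psd_form_null hLS hB Hy.1 Hu.1)//.
  by rewrite -L2S_norm_sqr u0 expr0n.
have y_neq0 : L2S_norm T y != 0.
  apply: contraTneq N0 => y0; rewrite -yN -leNgt (Bs _ _ Hy.1 Hu.1).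
  rewrite (psd_form_null hLS hB Hu.1 Hy.1)//.
  by rewrite -L2S_norm_sqr y0 expr0n.
pose E2 := 2 * pi * C * N.
have E20 : 0 < E2 by rewrite !mulr_gt0.
have bound z : H12S T z -> `|L2S_ip T y z| <= Num.sqrt E2 * H12S_norm T z.
  move=> /yz hz; rewrite -(ler_pXn2r (n := 2))// ?nnegrE//; last first.
    by rewrite mulr_ge0 ?sqrtr_ge0 ?H12S_norm_ge0.
  by rewrite real_normK ?num_real// exprMn sqr_sqrtr// ltW.
have [DE DN] := H12S_dual_norm_bounds (sqrtr_ge0 E2) bound Hu u_neq0.
apply: (@le_trans _ _ (`|L2S_ip T u y| / H12S_dual_norm T y)%:E); last first.
  by apply: ereal_sup_ubound; exists y.
rewrite (Bs _ _ Hu.1 Hy.1) yN lee_fin (gtr0_norm N0).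
rewrite yN (gtr0_norm N0) in DN.
move: DE DN; have := H12S_dual_norm_ge0 T y.
move: (H12S_dual_norm T y) (H12S_norm T u) (H12S_norm T w) w0 wN => D U W W0 WN D0 DE DN.
have Dpos : 0 < D.
  rewrite lt_neqAle D0 andbT eq_sym; apply: contraTneq DN => ->.
  by rewrite mul0r -ltNge.
have D2 : D ^+ 2 <= E2.
  by rewrite -(sqr_sqrtr (ltW E20)) lerXn2r ?nnegrE ?sqrtr_ge0.
rewrite ler_pdivlMr// -(ler_pXn2r (n := 2))// ?nnegrE ?(ltW N0)//; last first.
  by rewrite !mulr_ge0 ?invr_ge0 ?(ltW k0) ?(ltW W0).
rewrite (_ : (k^-1 * W * D) ^+ 2 = k ^- 2 * (W ^+ 2 * D ^+ 2)); last first.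
  by rewrite (exprMn _ (k^-1 * W)) (exprMn _ k^-1) exprVn; exact/esym/mulrA.
have k2 : k ^+ 2 = 64 * n%:R ^+ 2 * C.
  by rewrite /k !exprMn sqr_sqrtr ?(ltW C0)//; congr (_ * _ * _); ring.
rewrite mulrC ler_pdivrMr ?exprn_gt0// k2.
apply: (@le_trans _ _ (32 * n%:R ^+ 2 / pi * N * E2)).
  by rewrite ler_pM ?sqr_ge0.
rewrite le_eqVlt; apply/orP; left; apply/eqP; rewrite /E2.
by move: (pi : R) (lt0r_neq0 pi0) => p p0; field.
Qed.
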